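(* Let $\pi=\pi_1/\pi_2/\cdots/\pi_{\ell(\pi)}$ be a set partition of $[n]$ with $n\ge1$. Then $$\Theta_{\mathrm{NCSym}}(\mathbf p_\pi)=\begin{cases}2^{\ell(\pi)}\mathbf p_\pi&\text{if every block of }\pi\text{ has odd size},\\0&\text{otherwise.}\end{cases}$$ Consequently $\Theta_{\mathrm{NCSym}}\circ\omega=\omega\circ\Theta_{\mathrm{NCSym}}$ on $\mathrm{NCSym}$.
   Context: Let $\mathbf x_1,\mathbf x_2,\dots$ be noncommuting variables over $\mathbb Q$, $[m]=\{1,\dots,m\}$. A set partition $\pi$ of $[n]$ has blocks $\pi_1,\dots,\pi_{\ell(\pi)}$. $\mathbf m_\pi=\sum\mathbf x_{i_1}\cdots\mathbf x_{i_n}$ over tuples of positive integers with $i_j=i_k$ iff $j,k$ lie in the same block of $\pi$; $\mathbf p_\pi=\sum\mathbf x_{i_1}\cdots\mathbf x_{i_n}$ over tuples with $i_j=i_k$ whenever $j,k$ lie in the same block of $\pi$; $\mathbf e_\pi=\sum\mathbf x_{i_1}\cdots\mathbf x_{i_n}$ over tuples with $i_j\ne i_k$ whenever $j\ne k$ lie in the same block; $\mathbf h_\pi=\sum c\,\mathbf x_{i_1}\cdots\mathbf x_{i_n}$ where the coefficient $c$ of a tuple is $\prod_{b,v}(\#\{j\in\pi_b:i_j=v\})!$. $\mathrm{NCSym}$ is the span of all $\mathbf m_\pi$; $\omega:\mathrm{NCSym}\to\mathrm{NCSym}$ is the linear involution with $\omega(\mathbf h_\pi)=\mathbf e_\pi$.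 $\mathrm{NCSym}\subseteq\mathrm{NCQSym}$, where for a set composition $\phi$ of $[n]$ (sequence of disjoint nonempty blocks with union $[n]$) $\mathbf M_\phi=\sum\mathbf x_{i_1}\cdots\mathbf x_{i_n}$ over tuples with $i_j=i_k$ iff $j,k$ in the same block and $i_j<i_k$ iff the block of $j$ is left of that of $k$, and $\mathrm{NCQSym}$ is the span of all $\mathbf M_\phi$. For $A=\{a_1<\dots<a_k\}\subseteq[n-1]$ and $\sigma\in\mathfrak S_n$, $\mathbf F_{(A,\sigma)}=\sum_f\mathbf x_{f(\sigma^{-1}(1))}\cdots\mathbf x_{f(\sigma^{-1}(n))}$ over weakly increasing $f:[n]\to\{1,2,\dots\}$ with $f(i)<f(i+1)$ for $i\in A$; these with $\mathrm{Des}(\sigma)=\{i:\sigma(i)>\sigma(i+1)\}\subseteq A$ form a basis of $\mathrm{NCQSym}$. Order nonzero integers by $-1\prec1\prec-2\prec2\prec\cdots$; for $\gamma,\sigma\in\mathfrak S_n$, $\mathbf K_{(\gamma,\sigma)}=\sum_f\mathbf x_{|f(\sigma^{-1}(1))|}\cdots\mathbf x_{|f(\sigma^{-1}(n))|}$ over $f:[n]\to\mathbb Z\setminus\{0\}$, $f(1)\preceq\cdots\preceq f(n)$, with $f(i)=f(i+1)>0\Rightarrow\gamma(i)<\gamma(i+1)$ and $f(i)=f(i+1)<0\Rightarrow\gamma(i)>\gamma(i+1)$; it depends only on $\mathrm{Peak}(\gamma)=\{i:\gamma(i-1)<\gamma(i)>\gamma(i+1)\}$ and $\sigma$, so $\mathbf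 K_{(B,\sigma)}$ is defined for each peak set $B$ (subset of $\{2,\dots,n-1\}$ without consecutive integers). $\Theta_{\mathrm{NCQSym}}$ is the linear map on $\mathrm{NCQSym}$ with $\mathbf F_{(A,\sigma)}\mapsto\mathbf K_{(A\setminus((A+1)\cup\{1\}),\sigma)}$ for $\mathrm{Des}(\sigma)\subseteq A$ ($A+1=\{a+1:a\in A\}$), and $\Theta_{\mathrm{NCSym}}$ is its restriction to $\mathrm{NCSym}$. *)

(* Defs.v *)
From HB Require Import structures.
From mathcomp Require Import all_boot all_order all_algebra all_fingroup.
From mathcomp Require Import boolp classical_sets functions cardinality fsbigop.

Set Implicit Arguments.
Unset Strict Implicit.
Unset Printing Implicit Defensive.

Import Order.TTheory GRing.Theory Num.Theory.
Local Open Scope ring_scope.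

(* Indices are shifted down by one: the elements 1, ..., n of [n] are the
   ordinals 0, ..., n-1 of 'I_n, a subset of [n] (in particular a descent or
   peak set) is a {set 'I_n}, and the variable x_(i+1) is the letter i : nat.
   A formal power series over rat in these noncommuting variables is the
   function giving the coefficient of each word. *)
Notation ncseries := (seq nat -> rat^o).

(* The monomial x_(i_1) ... x_(i_n) of a tuple. *)
Definition word (n : nat) (i : {ffun 'I_n -> nat}) : seq nat :=
  [seq i j | j : 'I_n].

(* The infinite sum of the c t * x_(g t) over the t in D; all its uses below
   have only finitely many t for each word w. *)
Definition ncsum (T : choiceType) (D : set T) (c : T -> rat)
    (g : T -> seq nat) : ncseries :=
  fun w => \sum_(t \in [set t | D t /\ g t = w]%classic) c t.

Definition span (S : set ncseries) : set ncseries :=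
  [set f | exists (k : nat) (c : 'I_k -> rat) (g : 'I_k -> ncseries),
     (forall i, S (g i)) /\ f = \sum_(i < k) c i *: g i]%classic.

Definition linear_on (S : set ncseries) (T : ncseries -> ncseries) : Prop :=
  forall (a : rat) (u v : ncseries), S u -> S v ->
    T (a *: u + v) = a *: T u + T v.

Definition set_partition (n : nat) (pi : {set {set 'I_n}}) : bool :=
  finset.partition pi [set: 'I_n].

Definition same_block (n : nat) (pi : {set {set 'I_n}}) (j k : 'I_n) : bool :=
  [exists B in pi, (j \in B) && (k \in B)].

Definition nc_m (n : nat) (pi : {set {set 'I_n}}) : ncseries :=
  ncsum [set i : {ffun 'I_n -> nat} |
           forall j k, i j = i k <-> same_block pi j k]%classic
        (fun=> 1) (@word n).

Definition nc_p (n : nat) (pi : {set {set 'I_n}}) : ncseries :=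
  ncsum [set i : {ffun 'I_n -> nat} |
           forall j k, same_block pi j k -> i j = i k]%classic
        (fun=> 1) (@word n).

Definition nc_e (n : nat) (pi : {set {set 'I_n}}) : ncseries :=
  ncsum [set i : {ffun 'I_n -> nat} |
           forall j k, j <> k -> same_block pi j k -> i j <> i k]%classic
        (fun=> 1) (@word n).

(* Values v that do not occur in i would contribute the factor 0`! = 1. *)
Definition h_coef (n : nat) (pi : {set {set 'I_n}}) (i : {ffun 'I_n -> nat}) :
    nat :=
  \prod_(B in pi) \prod_(v <- undup (word i)) (#|[set j in B | i j == v]|)`!.

Definition nc_h (n : nat) (pi : {set {set 'I_n}}) : ncseries :=
  ncsum [set: {ffun 'I_n -> nat}]%classic (fun i => (h_coef pi i)%:R)
        (@word n).

Definition NCSym : set ncseries :=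
  span [set f | exists (n : nat) (pi : {set {set 'I_n}}),
          set_partition pi /\ f = nc_m pi]%classic.

Definition is_omega (w : ncseries -> ncseries) : Prop :=
  [/\ linear_on NCSym w,
      forall f, NCSym f -> NCSym (w f) /\ w (w f) = f
    & forall (n : nat) (pi : {set {set 'I_n}}),
        set_partition pi -> w (nc_h pi) = nc_e pi].

(* The values outside NCSym are irrelevant. *)
Definition omega : ncseries -> ncseries := xget (fun=> 0) is_omega.

Definition set_composition (n : nat) (phi : seq {set 'I_n}) : bool :=
  uniq phi && finset.partition [set B in phi] [set: 'I_n].

Definition block_index (n : nat) (phi : seq {set 'I_n}) (j : 'I_n) : nat :=
  find (fun B : {set 'I_n} => j \in B) phi.

Definition nc_M (n : nat) (phi : seq {set 'I_n}) : ncseries :=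
  ncsum [set i : {ffun 'I_n -> nat} | forall j k,
           (i j = i k <-> block_index phi j = block_index phi k) /\
           ((i j < i k)%N <-> (block_index phi j < block_index phi k)%N)
        ]%classic
        (fun=> 1) (@word n).

Definition NCQSym : set ncseries :=
  span [set f | exists (n : nat) (phi : seq {set 'I_n}),
          set_composition phi /\ f = nc_M phi]%classic.

Definition Des (n : nat) (s : 'S_n) : {set 'I_n} :=
  [set i : 'I_n | [exists j : 'I_n, (j == i.+1 :> nat) && (s j < s i)%N]].

Definition Peak (n : nat) (s : 'S_n) : {set 'I_n} :=
  [set i : 'I_n | [exists h : 'I_n, [exists j : 'I_n,
     [&& i == h.+1 :> nat, j == i.+1 :> nat, (s h < s i)%N & (s j < s i)%N]]]].

Definition nc_F (n : nat) (A : {set 'I_n}) (s : 'S_n) : ncseries :=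
  ncsum [set f : {ffun 'I_n -> nat} |
           (forall i j : 'I_n, (i <= j)%N -> (f i <= f j)%N) /\
           (forall i j : 'I_n, j = i.+1 :> nat -> i \in A -> (f i < f j)%N)
        ]%classic
        (fun=> 1) (fun f => word [ffun j => f ((s^-1)%g j)]).

(* -1 < 1 < -2 < 2 < ... *)
Definition pm_le (a b : int) : bool :=
  (`|a| < `|b|)%N || ((`|a|%N == `|b|%N) && (a <= b)).

(* The letter of x_|a| is |a| - 1, for a nonzero. *)
Definition nc_K (n : nat) (g s : 'S_n) : ncseries :=
  ncsum [set f : {ffun 'I_n -> int} |
           [/\ forall i, f i != 0,
               forall i j : 'I_n, (i <= j)%N -> pm_le (f i) (f j),
               forall i j : 'I_n, j = i.+1 :> nat ->
                 f i = f j -> 0 < f i -> (g i < g j)%N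
             & forall i j : 'I_n, j = i.+1 :> nat ->
                 f i = f j -> f i < 0 -> (g i > g j)%N]]%classic
        (fun=> 1) (fun f => word [ffun j => (`|f ((s^-1)%g j)|%N).-1]).

(* nc_K g s depends only on Peak g and s, so that any g with peak set B may be
   picked; the value 0 is for sets B that are not peak sets. *)
Definition nc_Kpeak (n : nat) (B : {set 'I_n}) (s : 'S_n) : ncseries :=
  if [pick g : 'S_n | Peak g == B] is Some g then nc_K g s else 0.

(* A \ ((A + 1) U {1}) *)
Definition peak_part (n : nat) (A : {set 'I_n}) : {set 'I_n} :=
  A :\: ([set i : 'I_n | [exists a in A, i == a.+1 :> nat]] :|:
         [set i : 'I_n | i == 0%N :> nat]).

(* The condition i.+1 < n says that A is contained in [n-1]. *)
Definition is_Theta (T : ncseries -> ncseries) : Prop :=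
  linear_on NCQSym T /\
  forall (n : nat) (A : {set 'I_n}) (s : 'S_n),
    (forall i, i \in A -> (i.+1 < n)%N) -> Des s \subset A ->
    T (nc_F A s) = nc_Kpeak (peak_part A) s.

(* The values outside NCQSym are irrelevant. *)
Definition Theta_NCQSym : ncseries -> ncseries := xget (fun=> 0) is_Theta.

(* The restriction of Theta_NCQSym to NCSym, extended by 0. *)
Definition Theta_NCSym : ncseries -> ncseries :=
  patch (fun=> 0) NCSym Theta_NCQSym.

(* Main.v *)
(* On F_(A,sigma), Theta is the passage to the signed alphabet in which equal
   negative letters must be separated by A. A formula for this passage that
   makes sense for every series f is obtained by replacing each letter by one positive
   copy and k negative copies, each negative copy carrying the weight -1, and
   evaluating the resulting polynomial in k at k = -1. On F_(A,sigma) this gives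
   the coefficients of K by an order-polynomial reciprocity, and the sum over
   signs only sees the peaks; as the F_(A,sigma) with Des(sigma) in A span all
   quasi-symmetric series, the formula computes Theta. On p_pi the copies are
   constant on blocks, so the polynomial is prod_B (1 + k (-1)^|B|), which at
   k = -1 is prod_B (1 - (-1)^|B|).

   For omega, h_pi is the sum of p_(cycles of s) over the permutations s that
   preserve the blocks of pi, and e_pi is the same sum weighted by sgn(s). This
   is triangular, so every p_pi is an eigenvector of omega, as it is of Theta, and
   the p_pi span NCSym. *)
Require Import Defs.
From mathcomp Require Import all_boot all_order all_algebra all_fingroup.
From mathcomp Require Import boolp classical_sets functions cardinality fsbigop.
From mathcomp Require Import ring lra zify.
Import Defs Order.TTheory GRing.Theory Num.Theory.
Local Open Scope ring_scope.

Set Implicit Arguments.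
Unset Strict Implicit.
Unset Printing Implicit Defensive.

(** * Finite differences *)

Definition fdiff (f : nat -> rat) : nat -> rat := fun k => f k.+1 - f k.

Definition psum (f : nat -> rat) : nat -> rat := fun k => \sum_(i < k) f i.

Definition fdiff_nil (d : nat) (f : nat -> rat) : Prop :=
  forall k, iter d fdiff f k = 0.

(* If P is polynomial of degree at most n, this is P(-1), by the Newton
   expansion of (1 + Delta)^-1. *)
Definition at_minus1 (n : nat) (P : nat -> rat) : rat :=
  \sum_(j < n.+1) (-1) ^+ j * iter j fdiff P 0%N.

Lemma eq_fdiff f g : f =1 g -> fdiff f =1 fdiff g.
Proof. by move=> e k; rewrite /fdiff !e. Qed.

Lemma eq_iter_fdiff d f g : f =1 g -> iter d fdiff f =1 iter d fdiff g.
Proof. by move=> e; elim: d => //= d IH; apply: eq_fdiff. Qed.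

Lemma eq_fdiff_nil d f g : f =1 g -> fdiff_nil d f -> fdiff_nil d g.
Proof. by move=> e nf k; rewrite -(eq_iter_fdiff d e). Qed.

Lemma iter_fdiffD d f g k :
  iter d fdiff (fun j => f j + g j) k = iter d fdiff f k + iter d fdiff g k.
Proof. by elim: d k => //= d IH k; rewrite /fdiff !IH; ring. Qed.

Lemma iter_fdiffZ d a f k :
  iter d fdiff (fun j => a * f j) k = a * iter d fdiff f k.
Proof. by elim: d k => //= d IH k; rewrite /fdiff !IH; ring. Qed.

Lemma iter_fdiff_shift d f k :
  iter d fdiff (fun j => f j.+1) k = iter d fdiff f k.+1.
Proof. by elim: d k => //= d IH k; rewrite /fdiff !IH. Qed.

Lemma fdiff_psum f : fdiff (psum f) =1 f.
Proof. by move=> k; rewrite /fdiff /psum big_ord_recr /=; ring. Qed.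

Lemma fdiff_nilS d f : fdiff_nil d.+1 f <-> fdiff_nil d (fdiff f).
Proof. by rewrite /fdiff_nil; split=> h k; have := h k; rewrite iterSr. Qed.

Lemma fdiff_nil_leq d e f : (d <= e)%N -> fdiff_nil d f -> fdiff_nil e f.
Proof.
move=> /subnK<- nf k; rewrite iterD; move: k.
by elim: (e - d)%N => //= m IH k; rewrite /fdiff !IH subrr.
Qed.

Lemma fdiff_nilD d f g :
  fdiff_nil d f -> fdiff_nil d g -> fdiff_nil d (fun k => f k + g k).
Proof. by move=> nf ng k; rewrite iter_fdiffD nf ng addr0. Qed.

Lemma fdiff_nilZ d a f : fdiff_nil d f -> fdiff_nil d (fun k => a * f k).
Proof. by move=> nf k; rewrite iter_fdiffZ nf mulr0. Qed.

Lemma fdiff_nil_shift d f : fdiff_nil d f -> fdiff_nil d (fun k => f k.+1).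
Proof. by move=> nf k; rewrite iter_fdiff_shift nf. Qed.

Lemma fdiff_nil_cst a : fdiff_nil 1 (fun=> a).
Proof. by move=> k; rewrite /= /fdiff subrr. Qed.

Lemma fdiff_nil_psum d f : fdiff_nil d f -> fdiff_nil d.+1 (psum f).
Proof.
by move=> nf; apply/fdiff_nilS; apply: eq_fdiff_nil nf => k; rewrite fdiff_psum.
Qed.

Lemma fdiff_nilM d e f g :
  fdiff_nil d.+1 f -> fdiff_nil e.+1 g ->
  fdiff_nil (d + e).+1 (fun k => f k * g k).
Proof.
move: {-1}(d + e)%N (leqnn (d + e)) => m.
(* Stated with orders of vanishing instead of degrees, so that 0 is allowed, the claim goes by
   induction on a bound for the sum of the orders: the Leibniz rule lowers one order at a time. *)
suff H : forall m d e f g, (d + e <= m)%N -> fdiff_nil d f ->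
    fdiff_nil e g -> fdiff_nil m.-1 (fun k => f k * g k).
  by move=> le nf ng; apply: (H m.+2 d.+1 e.+1) => //; rewrite addSn addnS.
elim=> [|{}m IH] {}d {}e {}f {}g.
  rewrite leqn0 addn_eq0 => /andP[/eqP-> _] nf _ k /=.
  by have /= -> := nf k; rewrite mul0r.
case: d => [|d]; first by move=> _ nf _; apply: (@fdiff_nil_leq 0) => // k /=;
  have /= -> := nf k; rewrite mul0r.
case: e => [|e]; first by move=> _ _ ng; apply: (@fdiff_nil_leq 0) => // k /=;
  have /= -> := ng k; rewrite mulr0.
case: m IH => [|m] IH le nf ng; first by move: le; rewrite addSn addnS.
apply/fdiff_nilS.
have E k : fdiff f k * g k.+1 + f k * fdiff g k = fdiff (fun k => f k * g k) k.
  by rewrite /fdiff; ring.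
apply: (eq_fdiff_nil E); apply: fdiff_nilD.
  by apply: (IH d e.+1); [lia|exact/fdiff_nilS|exact: fdiff_nil_shift].
by apply: (IH d.+1 e); [lia| |exact/fdiff_nilS].
Qed.

(** The sum telescopes, since Delta^j c(1) = Delta^j c(0) + Delta^(j+1) c(0). The argument is
    shifted by one, so that evaluation at -1 reads off [c] at 0. *)
Lemma at_minus1E n c :
  fdiff_nil n.+1 c -> at_minus1 n (fun k => c k.+1) = c 0%N.
Proof.
move=> nc; suff: forall m, \sum_(j < m) (-1) ^+ j * iter j fdiff c 1%N =
    c 0%N - (-1) ^+ m * iter m fdiff c 0%N.
  move=> H; rewrite /at_minus1; under eq_bigr do rewrite iter_fdiff_shift.
  by rewrite H nc mulr0 subr0.
elim=> [|m IH]; first by rewrite big_ord0 /= mul1r subrr.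
by rewrite big_ord_recr IH /= exprS /fdiff; ring.
Qed.

Lemma eq_at_minus1 n f g : f =1 g -> at_minus1 n f = at_minus1 n g.
Proof.
by move=> e; apply: eq_bigr => j _; rewrite (eq_iter_fdiff j e).
Qed.

Lemma at_minus1D n f g :
  at_minus1 n (fun k => f k + g k) = at_minus1 n f + at_minus1 n g.
Proof.
by rewrite -big_split; apply: eq_bigr => j _; rewrite iter_fdiffD mulrDr.
Qed.

Lemma at_minus1Z n a f : at_minus1 n (fun k => a * f k) = a * at_minus1 n f.
Proof.
by rewrite big_distrr; apply: eq_bigr => j _; rewrite iter_fdiffZ /= mulrCA.
Qed.

Lemma at_minus1_0 n f : f =1 (fun=> 0) -> at_minus1 n f = 0.
Proof.
by move=> e; rewrite (eq_at_minus1 n (g := fun k => 0 * f k)) ?at_minus1Z ?mul0r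
  // => k; rewrite e mul0r.
Qed.

(** * Chains of levels *)

(** A transfer recursion: the total weight of the chains of [n] further elements that follow [x],
    the weight of [x] itself being left out. *)
Fixpoint chain_weight (T : finType) (W : T -> rat) (r : nat -> rel T)
    (n : nat) (x : T) : rat :=
  if n is m.+1 then
    \sum_y (r 0%N x y)%:R * (W y * chain_weight W (fun i => r i.+1) m y)
  else 1.

Definition ffun_cons (T : Type) n (x : T) (g : {ffun 'I_n -> T}) :
  {ffun 'I_n.+1 -> T} := [ffun i => if unlift ord0 i is Some j then g j else x].

Lemma ffun_cons0 T n x (g : {ffun 'I_n -> T}) : ffun_cons x g ord0 = x.
Proof. by rewrite ffunE unlift_none. Qed.

Lemma ffun_consS T n x (g : {ffun 'I_n -> T}) j :
  ffun_cons x g (lift ord0 j) = g j.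
Proof. by rewrite ffunE liftK. Qed.

Lemma big_ffun_cons (T : finType) n (F : {ffun 'I_n.+1 -> T} -> rat) :
  \sum_f F f = \sum_x \sum_(g : {ffun 'I_n -> T}) F (ffun_cons x g).
Proof.
rewrite pair_big /= (reindex (fun p : T * {ffun 'I_n -> T} =>
  ffun_cons p.1 p.2)) //.
exists (fun f : {ffun 'I_n.+1 -> T} => (f ord0, [ffun j => f (lift ord0 j)])).
  move=> [x g] _ /=; rewrite ffun_cons0; congr pair.
  by apply/ffunP => j; rewrite ffunE ffun_consS.
move=> f _; apply/ffunP => i; rewrite ffunE /=.
by case: unliftP => [j ->|->] //; rewrite ffunE.
Qed.

Definition chained (T : Type) n (r : nat -> rel T) (f : {ffun 'I_n -> T}) :
    bool :=
  [forall i : 'I_n, forall j : 'I_n, (j == i.+1 :> nat) ==> r i (f i) (f j)].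

Lemma chained_cons T n (r : nat -> rel T) x (g : {ffun 'I_n.+1 -> T}) :
  chained r (ffun_cons x g) =
    r 0%N x (g ord0) && chained (fun i => r i.+1) g.
Proof.
apply/forallP/andP => [H|[r0 /forallP H] i].
  split.
    have /forallP/(_ (lift ord0 ord0)) := H ord0.
    by rewrite ffun_cons0 ffun_consS.
  apply/forallP => i; apply/forallP => j; apply/implyP => e.
  have /forallP/(_ (lift ord0 j)) := H (lift ord0 i).
  by rewrite !ffun_consS !lift0 eqSS e.
apply/forallP => j; apply/implyP => e.
case: (unliftP ord0 j) e => [j' ->|->] //.
case: (unliftP ord0 i) => [i' ->|->]; rewrite ?ffun_cons0 !ffun_consS !lift0 eqSS.
  by move=> e; have /forallP/(_ j')/implyP/(_ e) := H i'.
by move=> /eqP e; have -> : j' = ord0 by apply: val_inj.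
Qed.

Lemma sum_chained_cons (T : finType) (W : T -> rat) (r : nat -> rel T) n x :
  \sum_(g : {ffun 'I_n -> T}) (\prod_i W (g i)) *
    (chained r (ffun_cons x g))%:R = chain_weight W r n x.
Proof.
elim: n r x => [|n IH] r x.
  rewrite (big_pred1 (finfun (fun i : 'I_0 => x))); last first.
    by move=> g; apply/esym/eqP/ffunP => -[].
  rewrite big_ord0 mul1r.
  have -> // : chained r (ffun_cons x [ffun _ : 'I_0 => x]).
  by apply/forallP => i; apply/forallP => j; rewrite [i]ord1 [j]ord1.
rewrite /= big_ffun_cons; apply: eq_bigr => y _.
rewrite -IH !big_distrr; apply: eq_bigr => g _ /=.
rewrite chained_cons ffun_cons0 -mulnb natrM big_ord_recl ffun_cons0.
rewrite (eq_bigr (fun i => W (g i))) => [|i _]; last by rewrite ffun_consS.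
by ring.
Qed.

Lemma sum_chained (T : finType) (W : T -> rat) (r : nat -> rel T) n :
  \sum_(f : {ffun 'I_n.+1 -> T}) (\prod_i W (f i)) * (chained r f)%:R =
  \sum_x W x * chain_weight W r n x.
Proof.
rewrite big_ffun_cons; apply: eq_bigr => x _.
rewrite -sum_chained_cons big_distrr; apply: eq_bigr => g _ /=.
rewrite big_ord_recl ffun_cons0.
rewrite (eq_bigr (fun i => W (g i))) => [|i _]; last by rewrite ffun_consS.
by ring.
Qed.

Variant gap := Free | Weak | Strict.

(* Level 0 is the positive copy of a letter, the levels 1, ..., k are its
   negative copies, listed from the largest to the smallest. *)
Definition level_rel (k : nat) (g : gap) : rel 'I_k.+1 :=
  match g with
  | Free => fun _ _ => true
  | Weak => fun x y => (y <= x)%N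
  | Strict => fun x y => (y < x)%N
  end.

(* true is the negative sign *)
Definition sign_rel (g : gap) : rel bool :=
  match g with
  | Free => fun _ _ => true
  | Weak => fun _ y => ~~ y
  | Strict => fun x _ => x
  end.

Definition level_weight (k : nat) (x : 'I_k.+1) : rat :=
  if x == ord0 then 1 else -1.

(** Level 0 counts positively, the levels 1, ..., [m] negatively. The value [r 0] is added and
    subtracted to turn the negative part into a full partial sum, which is polynomial in [m] when
    [r] is. *)
Lemma sum_level_weight k (F : 'I_k.+1 -> rat) (r : nat -> rat) m :
  (m <= k)%N -> (forall x : 'I_k.+1, (0 < x)%N -> F x = r x) ->
  \sum_(x : 'I_k.+1 | (x <= m)%N) level_weight x * F x =
  F ord0 + r 0%N - psum r m.+1.
Proof.
move=> le e; rewrite /psum (big_ord_widen k.+1) ?ltnS //.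
rewrite [in RHS](bigD1 ord0) //= [in LHS](bigD1 ord0) //=.
rewrite {1}/level_weight eqxx mul1r opprD -addrA addNKr; congr (_ + _).
rewrite -sumrN; apply: eq_bigr => x /andP[_ x0].
rewrite /level_weight (negbTE x0) mulN1r e // lt0n.
by apply: contraNneq x0 => x0; apply/eqP/val_inj.
Qed.

(* Reciprocity: both sides satisfy the same recursion, the value of a
   polynomial c at k = -1 being stored as c 0 and that at k as c k.+1. *)
Lemma chain_weight_poly (gs : nat -> gap) n :
  exists c r b d e, [/\ fdiff_nil d.+1 c, fdiff_nil e.+1 r, (d + e <= n)%N,
    (forall k, chain_weight (@level_weight k)
       (fun i => @level_rel k (gs i)) n ord0 = c k.+1 * b) /\
    (forall k (x : 'I_k.+1), (0 < x)%N -> chain_weight (@level_weight k)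
       (fun i => @level_rel k (gs i)) n x = c k.+1 * r x)
   & chain_weight (fun=> 1) (fun i => sign_rel (gs i)) n false = c 0%N * b /\
     chain_weight (fun=> 1) (fun i => sign_rel (gs i)) n true = c 0%N * r 0%N].
Proof.
elim: n gs => [|n IH] gs.
  exists (fun=> 1), (fun=> 1), 1, 0%N, 0%N; rewrite /= !mulr1.
  by split=> //; apply: fdiff_nil_cst.
have [c [r [b [d [e [nc nr le [E0 Ep] [Ef Et]]]]]]] := IH (fun i => gs i.+1).
have tot k m : (m <= k)%N ->
    \sum_(y : 'I_k.+1) (y <= m)%N%:R * (level_weight y * chain_weight
      (@level_weight k) (fun i => @level_rel k (gs i.+1)) n y) =
    c k.+1 * (b + r 0%N - psum r m.+1).
  move=> lem; pose F y := chain_weight (@level_weight k)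
    (fun i => @level_rel k (gs i.+1)) n y.
  transitivity (\sum_(y : 'I_k.+1 | (y <= m)%N) level_weight y * F y).
    rewrite [RHS]big_mkcond; apply: eq_bigr => y _.
    by case: (y <= m)%N; rewrite ?mul1r ?mul0r.
  rewrite (sum_level_weight (r := fun i => c k.+1 * r i)) //.
    by rewrite /F E0 /psum -mulr_sumr; ring.
  exact: Ep.
have nS : fdiff_nil e.+2 (fun z => b + r 0%N - psum r z).
  apply: fdiff_nilD; first by apply: fdiff_nil_leq (fdiff_nil_cst _).
  apply: (eq_fdiff_nil (f := fun z => -1 * psum r z)) => [z|].
    by rewrite mulN1r.
  exact/fdiff_nilZ/fdiff_nil_psum.
rewrite /= !big_bool !Ef !Et !mul1r.
case: (gs 0%N) => /=.
(* [Free]: all [k.+1] levels may follow, so the sum is absorbed into [c]. At 0 the partial sum is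
   empty and both signs remain. *)
- exists (fun j => c j * (b + r 0%N - psum r j)), (fun=> 1), 1, (d + e.+1)%N, 0%N.
  split; [exact: fdiff_nilM|exact: fdiff_nil_cst|lia| |].
    have H k : \sum_(y : 'I_k.+1) (1 : rat) * (level_weight y * chain_weight
        (@level_weight k) (fun i => @level_rel k (gs i.+1)) n y) =
        c k.+1 * (b + r 0%N - psum r k.+1).
      by rewrite -(tot k k) //; apply: eq_bigr => y _; rewrite -ltnS ltn_ord.
    by split=> [k|k x _]; rewrite H mulr1.
  by rewrite /psum big_ord0 !mulr1; split; ring.
(* [Weak]: the levels up to [x] may follow, whence [z.+1]. At [z = 0] only [b] is left, as only the
   positive sign may follow. *)
- exists c, (fun z => b + r 0%N - psum r z.+1), b, d, e.+1.
  split=> //; [exact: fdiff_nil_shift nS|lia| |].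
    split=> [k|k x _]; last by apply: tot; rewrite -ltnS.
    by rewrite -[RHS](_ : c k.+1 * (b + r 0%N - psum r 1) = _) ?tot //
       /psum big_ord1 addrK.
  by rewrite /psum big_ord1 addrK; split; ring.
(* [Strict]: nothing lies below level 0, whence 0 in place of [b]. At [z = 0] the partial sum is
   empty: both signs may follow a negative one. *)
- exists c, (fun z => b + r 0%N - psum r z), 0, d, e.+1.
  split=> //; [lia| |].
    split=> [k|k [[//|x] ltx] _]; last by apply: tot; rewrite ltnW.
    by rewrite mulr0 big1 // => y _; rewrite mul0r.
  by rewrite /psum big_ord0; split; ring.
Qed.

(** Summing also over the first level, the weighted count of level chains is polynomial in [k] of
    degree at most [n.+1], and [at_minus1E] reads its value at -1 as the number of sign patterns. *)
Lemma at_minus1_chainS (gs : nat -> gap) n :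
  at_minus1 n.+1 (fun k => \sum_(t : {ffun 'I_n.+1 -> 'I_k.+1})
    (\prod_i level_weight (t i)) *
      (chained (fun i => @level_rel k (gs i)) t)%:R) =
  \sum_(e : {ffun 'I_n.+1 -> bool}) (chained (fun i => sign_rel (gs i)) e)%:R.
Proof.
have [c [r [b [d [e [nc nr le [E0 Ep] [Ef Et]]]]]]] := chain_weight_poly gs n.
pose c' j := c j * (b + r 0%N - psum r j).
rewrite (eq_at_minus1 _ (g := fun k => c' k.+1)) => [|k].
  rewrite (at_minus1E (c := c')).
    have := sum_chained (fun=> 1) (fun i => sign_rel (gs i)) n.
    under [LHS]eq_bigr => f _ do rewrite big1 ?mul1r //.
    by rewrite big_bool !mul1r Ef Et /c' /psum big_ord0 => -> /=; ring.
  apply: (@fdiff_nil_leq (d + e.+1).+1); first by lia.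
  apply: fdiff_nilM => //; apply: fdiff_nilD.
    by apply: fdiff_nil_leq (fdiff_nil_cst _).
  apply: (eq_fdiff_nil (f := fun z => -1 * psum r z)) => [z|].
    by rewrite mulN1r.
  exact/fdiff_nilZ/fdiff_nil_psum.
rewrite sum_chained (eq_bigl (fun x : 'I_k.+1 => (x <= k)%N)) => [|x].
  rewrite (sum_level_weight (r := fun i => c k.+1 * r i)) // ?E0; last exact: Ep.
  by rewrite /c' /psum -mulr_sumr; ring.
by rewrite -ltnS ltn_ord.
Qed.

Lemma at_minus1_chain (gs : nat -> gap) n :
  at_minus1 n (fun k => \sum_(t : {ffun 'I_n -> 'I_k.+1})
    (\prod_i level_weight (t i)) *
      (chained (fun i => @level_rel k (gs i)) t)%:R) =
  \sum_(e : {ffun 'I_n -> bool}) (chained (fun i => sign_rel (gs i)) e)%:R.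
Proof.
case: n => [|n]; last exact: at_minus1_chainS.
have chT T (r : nat -> rel T) (f : {ffun 'I_0 -> T}) : chained r f.
  by apply/forallP => -[].
rewrite /at_minus1 big_ord1 /= mul1r.
rewrite (eq_bigr (fun=> 1)) => [|t _]; last by rewrite chT big_ord0 mul1r.
rewrite [RHS](eq_bigr (fun=> 1)) => [|t _]; last by rewrite chT.
by rewrite !sumr_const !card_ffun !card_ord !expn0.
Qed.

(** * Sign patterns and peaks *)

(** A [Weak] gap forces the sign on its right to be positive, a [Strict] gap forces the sign on its
    left to be negative. These constraints clash only at a [Weak] gap followed by a [Strict] one;
    without a clash, each gap that is not [Free] halves the count. *)
Lemma sum_chained_sign (gs gs' : nat -> gap) n :
  (forall i, gs i = Free <-> gs' i = Free) ->
  (forall i, (gs i = Weak /\ gs i.+1 = Strict) <->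
             (gs' i = Weak /\ gs' i.+1 = Strict)) ->
  \sum_(e : {ffun 'I_n -> bool}) (chained (fun i => sign_rel (gs i)) e)%:R =
  \sum_(e : {ffun 'I_n -> bool})
    (chained (fun i => sign_rel (gs' i)) e)%:R :> rat.
Proof.
pose x gs n := chain_weight (fun=> 1) (fun i => sign_rel (gs i)) n.
(* [X gs n] is the count for [n] gaps; the test [0 < m] keeps [gs 1] out when only one gap is
   left. *)
pose fix X gs n : rat := if n is m.+1 then
  let Y := X (fun i => gs i.+1) m in
  match gs 0%N with
  | Free => 2 * Y
  | Strict => Y
  | Weak => if (0 < m)%N then if gs 1%N is Strict then 0 else Y else Y
  end else 2.
have xX : forall n gs, x gs n false + x gs n true = X gs n /\
    x gs n false = (if (0 < n)%N then if gs 0%N is Strict then 0 else X gs n / 2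
                    else X gs n / 2).
  elim=> [|{}n IH] {}gs; first by rewrite /x /=; split; lra.
  have [tot fst] := IH (fun i => gs i.+1).
  have xE b : x gs n.+1 b =
      (sign_rel (gs 0%N) b true)%:R * x (fun i => gs i.+1) n true +
      (sign_rel (gs 0%N) b false)%:R * x (fun i => gs i.+1) n false.
    by rewrite {1}/x /= big_bool !mul1r.
  rewrite !xE /=.
  case: (gs 0%N) => /=; rewrite ?mul1r ?mul0r ?addr0 ?add0r.
  - by split; lra.
  - move: tot fst; case: (n) => [|m] /=; first by split; lra.
    by case: (gs 1%N) => /=; split; lra.
  - by split; lra.
have XE : forall n gs gs', (forall i, gs i = Free <-> gs' i = Free) ->
    (forall i, (gs i = Weak /\ gs i.+1 = Strict) <->
               (gs' i = Weak /\ gs' i.+1 = Strict)) -> X gs n = X gs' n.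
  elim=> [|{}n IH] {}gs {}gs' ef ew //=.
  rewrite (IH (fun i => gs i.+1) (fun i => gs' i.+1)) //.
  move: (ef 0%N) (ef 1%N) (ew 0%N).
  case: (gs 0%N) (gs 1%N) (gs' 0%N) (gs' 1%N) => [] [] [] [] ;
    case: (n) => [|m] //=; try by intuition discriminate.
move=> ef ew; case: n => [|n].
  by apply: eq_bigr => f _; congr (nat_of_bool _)%:R; apply/forallP/forallP => _ [].
have tot g : \sum_(e : {ffun 'I_n.+1 -> bool})
    (chained (fun i => sign_rel (g i)) e)%:R = X g n.
  have := sum_chained (fun=> 1) (fun i => sign_rel (g i)) n.
  under [LHS]eq_bigr => f _ do rewrite big1 ?mul1r //.
  by rewrite big_bool !mul1r -/(x g n) => ->; have [<- _] := xX n g; rewrite addrC.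
by rewrite !tot; apply: XE.
Qed.


(** * Coefficients *)

Lemma size_word n (i : {ffun 'I_n -> nat}) : size (word i) = n.
Proof. by rewrite size_map -cardE card_ord. Qed.

Lemma nth_word n (i : {ffun 'I_n -> nat}) (j : 'I_n) : nth 0%N (word i) j = i j.
Proof. by rewrite (nth_map j) ?nth_ord_enum // -cardE card_ord. Qed.

Definition letters n (w : seq nat) : {ffun 'I_n -> nat} :=
  [ffun j : 'I_n => nth 0%N w j].

Lemma wordK n : cancel (@word n) (letters n).
Proof. by move=> i; apply/ffunP => j; rewrite ffunE nth_word. Qed.

Lemma lettersK n w : size w = n -> word (letters n w) = w.
Proof.
move=> sw; apply: (@eq_from_nth _ 0%N) => [|k]; rewrite size_word ?sw // => lt.
by rewrite (nth_word _ (Ordinal lt)) ffunE.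
Qed.

Lemma ncsum_inj (T : choiceType) (D : set T) c (g : T -> seq nat) t :
  injective g -> ncsum D c g (g t) = if `[< D t >] then c t else 0.
Proof.
move=> ig; rewrite /ncsum; case: asboolP => Dt.
  rewrite (_ : mkset _ = [set t]%classic) ?fsbig_set1 //.
  by apply/seteqP; split => [s [_ /ig]|s ->].
rewrite (_ : mkset _ = classical_sets.set0) ?fsbig_set0 //.
by apply/seteqP; split => // s [Ds /ig e]; case: Dt; rewrite -e.
Qed.

Definition homog (n : nat) (f : ncseries) : Prop :=
  forall w, size w <> n -> f w = 0.

Lemma homog_ncsum n (T : choiceType) (D : set T) c (g : T -> seq nat) :
  (forall t, size (g t) = n) -> homog n (ncsum D c g).
Proof.
move=> sg w sw; rewrite /ncsum (_ : mkset _ = classical_sets.set0) ?fsbig_set0 //.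
by apply/seteqP; split => // t [_ e]; case: sw; rewrite -e.
Qed.

Lemma homog0 n : homog n 0.
Proof. by []. Qed.

Lemma homogZ n a f : homog n f -> homog n (a *: f).
Proof. by move=> hf w sw; rewrite /= fctE hf ?scaler0. Qed.

Lemma homogD n f g : homog n f -> homog n g -> homog n (f + g).
Proof. by move=> hf hg w sw; rewrite /= fctE hf // hg // addr0. Qed.

Lemma homog_sum n (I : Type) (r : seq I) (P : pred I) (F : I -> ncseries) :
  (forall i, P i -> homog n (F i)) -> homog n (\sum_(i <- r | P i) F i).
Proof.
move=> hF; elim/big_rec: _ => [|i f Pi hf]; first exact: homog0.
by apply: homogD; [apply: hF|].
Qed.

Lemma homog_ext n f g : homog n f -> homog n g ->
  (forall i : {ffun 'I_n -> nat}, f (word i) = g (word i)) -> f = g.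
Proof.
move=> hf hg e; apply/funext => w; have [sw|sw] := pselect (size w = n).
  by rewrite -(lettersK sw).
by rewrite hf // hg.
Qed.

Lemma sum_apply (I : Type) (r : seq I) (P : pred I) (F : I -> ncseries) w :
  (\sum_(i <- r | P i) F i) w = \sum_(i <- r | P i) F i w.
Proof. by elim/big_ind2: _ => // f x g y <- <-. Qed.

(** As i_j = f(s^-1(j)) in [nc_F], the only f that produces the word of [i] is [i] composed with
    [s]; in [nc_K] the same holds up to signs and a shift by one. *)
Definition pull n (s : 'S_n) (i : {ffun 'I_n -> nat}) : {ffun 'I_n -> nat} :=
  [ffun x => i (s x)].

Definition incr n (v : {ffun 'I_n -> nat}) : bool :=
  [forall x : 'I_n, forall y : 'I_n, (x <= y)%N ==> (v x <= v y)%N].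

Definition strict_at n (A : {set 'I_n}) (v : {ffun 'I_n -> nat}) : bool :=
  [forall x : 'I_n, forall y : 'I_n,
     (y == x.+1 :> nat) && (x \in A) ==> (v x < v y)%N].

Lemma incrP n (v : {ffun 'I_n -> nat}) :
  reflect (forall x y : 'I_n, (x <= y)%N -> (v x <= v y)%N) (incr v).
Proof.
apply: (iffP forallP) => [h x y|h x]; first by have /forallP/(_ y)/implyP := h x.
by apply/forallP => y; apply/implyP; apply: h.
Qed.

Lemma strict_atP n (A : {set 'I_n}) (v : {ffun 'I_n -> nat}) :
  reflect (forall x y : 'I_n, y = x.+1 :> nat -> x \in A -> (v x < v y)%N)
    (strict_at A v).
Proof.
apply: (iffP forallP) => [h x y e xA|h x].
  by have /forallP/(_ y)/implyP := h x; apply; rewrite e eqxx.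
by apply/forallP => y; apply/implyP => /andP[/eqP e xA]; apply: h.
Qed.

Lemma homog_F n (A : {set 'I_n}) s : homog n (nc_F A s).
Proof. by apply: homog_ncsum => f; rewrite size_word. Qed.

Lemma nc_F_word n (A : {set 'I_n}) s i :
  nc_F A s (word i) = (incr (pull s i) && strict_at A (pull s i))%:R.
Proof.
pose G (f : {ffun 'I_n -> nat}) := word [ffun j => f ((s^-1)%g j)].
have -> : word i = G (pull s i).
  by congr word; apply/ffunP => j; rewrite !ffunE permKV.
rewrite /nc_F -/G ncsum_inj.
  case: asboolP => [[/incrP-> /strict_atP->] //|]; case: andP => // -[a b] [].
  by split; [apply/incrP|apply/strict_atP].
move=> f g /(can_inj (@wordK n)) /ffunP e; apply/ffunP => x.
by have := e (s x); rewrite !ffunE permK.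
Qed.

(* The gap i lies between the positions i and i + 1; those beyond the word are
   Free. *)
Definition gap_of n (A : {set 'I_n}) (v : {ffun 'I_n -> nat}) (i : nat) : gap :=
  if (i.+1 < n)%N && (nth 0%N (word v) i == nth 0%N (word v) i.+1) then
    if [exists a in A, a == i :> nat] then Strict else Weak
  else Free.

Lemma gap_ofE n (A : {set 'I_n}) (v : {ffun 'I_n -> nat}) (x y : 'I_n) :
  y = x.+1 :> nat ->
  gap_of A v x = if v x == v y then if x \in A then Strict else Weak else Free.
Proof.
move=> e; rewrite /gap_of -e ltn_ord !nth_word /=.
have -> // : [exists a in A, a == x :> nat] = (x \in A).
by apply/existsP/idP => [[a /andP[aA /eqP/val_inj <-]]|xA] //;
  exists x; rewrite xA eqxx.
Qed.

Definition signed_letters n (v : {ffun 'I_n -> nat}) (e : {ffun 'I_n -> bool}) :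
    {ffun 'I_n -> int} :=
  [ffun x => if e x then - (v x).+1%:Z else (v x).+1%:Z].

Lemma homog_K n (g s : 'S_n) : homog n (nc_K g s).
Proof. by apply: homog_ncsum => f; rewrite size_word. Qed.

Lemma mem_DesE n (g : 'S_n) (x y : 'I_n) :
  y = x.+1 :> nat -> (x \in Des g) = (g y < g x)%N.
Proof.
move=> e; rewrite inE; apply/existsP/idP => [[j /andP[/eqP ej]]|lt].
  by have -> // : j = y by apply: val_inj; rewrite /= ej e.
by exists y; rewrite e eqxx.
Qed.

(** The absolute values of f are forced, so f amounts to a choice of signs. Equal letters come with
    negatives before positives; an ascent of [g] also forbids two negatives, which makes the second
    sign positive, and a descent forbids two positives, which makes the first sign negative. *)
Lemma nc_K_word n (g s : 'S_n) i :
  nc_K g s (word i) = if incr (pull s i) then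
    \sum_(e : {ffun 'I_n -> bool})
      (chained (fun k => sign_rel (gap_of (Des g) (pull s i) k)) e)%:R else 0.
Proof.
set v := pull s i.
pose P (e : {ffun 'I_n -> bool}) :=
  incr v && chained (fun k => sign_rel (gap_of (Des g) v k)) e.
transitivity (\sum_(e | P e) 1 : rat); last first.
  rewrite /P; case: (incr v); last by rewrite big_pred0.
  by rewrite big_mkcond; apply: eq_bigr => e _; case: (chained _ _).
rewrite (bigfs _ (index_enum_uniq _)) => [|e _]; last by rewrite mem_index_enum.
rewrite /nc_K /ncsum; apply: (reindex_fsbig (signed_letters v)).
have slE e x : signed_letters v e x =
    if e x then - (v x).+1%:Z else (v x).+1%:Z by rewrite ffunE.
have abs e x : `|signed_letters v e x|%N = (v x).+1.
  by rewrite slE; case: (e x); rewrite ?abszN.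
have pos e x : (0 < signed_letters v e x) = ~~ e x.
  by rewrite slE; case: (e x) => //; rewrite oppr_gt0.
have neg e x : (signed_letters v e x < 0) = e x.
  by rewrite slE; case: (e x) => //; rewrite oppr_lt0.
have eqsl e x y : signed_letters v e x = signed_letters v e y <->
    v x = v y /\ e x = e y.
  split=> [E|[E1 E2]]; last by rewrite !slE E1 E2.
  split; first by have := congr1 absz E; rewrite !abs => -[].
  by apply: negb_inj; rewrite -!pos E.
have le e x y : pm_le (signed_letters v e x) (signed_letters v e y) =
    (v x < v y)%N || (v x == v y) && (e x || ~~ e y).
  rewrite /pm_le !abs ltnS eqSS; case: ltngtP => //= E; rewrite !slE E.
  by case: (e x) (e y) => [] [] /=; rewrite ?lexx //; lia.
split.
- move=> e /= /andP[/incrP iv /forallP ch]; split; last first.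
    by congr word; apply/ffunP => j; rewrite ffunE abs /= ffunE permKV.
  have {}ch (x y : 'I_n) : y = x.+1 :> nat -> sign_rel (gap_of (Des g) v x) (e x) (e y).
    by move=> E; have /forallP/(_ y) := ch x; rewrite E eqxx.
  split.
  + by move=> x; rewrite -absz_eq0 abs.
  (* The order is known for neighbours and is carried to all pairs by induction on the distance. *)
  + move=> x y; move: {2}(y - x)%N (erefl (y - x)%N) => m.
    elim: m y => [|m IH] y.
      move=> E lexy; have -> : y = x by apply: val_inj => /=; lia.
      by rewrite le eqxx orbN orbT.
    move=> E lexy; have lt : (y.-1 < n)%N by have := ltn_ord y; lia.
    pose z := Ordinal lt; have Ez : y = z.+1 :> nat by rewrite /=; lia.
    have := IH z; rewrite !le => /(_ _ _)/=.
    move=> /(_ ltac:(lia) ltac:(lia)).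
    have := iv z y; rewrite Ez => /(_ (leqnSn _)).
    rewrite leq_eqVlt => /orP[/eqP Evz|lt'].
      have := ch _ _ Ez; rewrite (gap_ofE _ _ Ez) Evz eqxx.
      case: ltngtP => //= _; case: (z \in Des g) => /=.
        by move=> ->; rewrite orbF => ->.
      by move=> ->; rewrite orbT.
    move=> /orP[lt2|/andP[/eqP E2 _]]; first by rewrite (ltn_trans lt2 lt').
    by rewrite E2 lt'.
  + move=> x y E /eqsl[E1 E2]; rewrite pos => ex.
    have := ch _ _ E; rewrite (gap_ofE _ _ E) E1 eqxx (mem_DesE _ E).
    case: ltngtP => //= [|/val_inj/perm_inj exy]; first by rewrite (negbTE ex).
    by move: E; rewrite exy; lia.
  + move=> x y E /eqsl[E1 E2]; rewrite neg => ex.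
    have := ch _ _ E; rewrite (gap_ofE _ _ E) E1 eqxx (mem_DesE _ E).
    by case: ltngtP => //=; rewrite -E2 ex.
- move=> e e' _ _ E; apply/ffunP => x.
  by apply: negb_inj; rewrite -!pos E.
- move=> f [[f0 fle fpos fneg] fw].
  have fv x : `|f x|%N = (v x).+1.
    have := congr1 (letters n) fw; rewrite !wordK => /ffunP/(_ (s x)).
    rewrite ffunE permK /v [in X in _ -> _ = X.+1]ffunE => <-.
    by rewrite prednK // absz_gt0.
  exists [ffun x => f x < 0]; last first.
    apply/ffunP => x; rewrite slE ffunE -fv.
    by case: ltrP => H; lia.
  have iv : incr v.
    by apply/incrP => x y /fle; rewrite /pm_le !fv; lia.
  rewrite /= /P iv; apply/forallP => x; apply/forallP => y; apply/implyP => /eqP E.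
  rewrite (gap_ofE _ _ E) (mem_DesE _ E).
  rewrite [X in sign_rel _ X]ffunE [X in sign_rel _ _ X]ffunE.
  have := fle x y; rewrite E => /(_ (leqnSn _)); rewrite /pm_le !fv ltnS eqSS.
  case: eqP => [Ev|//]; rewrite Ev ltnn /= => lef.
  have eqf : (f x < 0) = (f y < 0) -> f x = f y.
    by have := fv x; have := fv y; have := f0 x; have := f0 y; lia.
  case: ltnP => /= H.
    apply/negPn; rewrite -leNgt; apply/negP => fx.
    have Exy : f x = f y by apply: eqf; rewrite !ltNge fx (le_trans fx lef).
    have fx0 : 0 < f x by rewrite lt_def f0.
    by have := fpos _ _ E Exy fx0; rewrite ltnNge ltnW.
  apply/negP => fy.
  have Exy : f x = f y by apply: eqf; rewrite fy (le_lt_trans lef fy).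
  by have := fneg _ _ E Exy; rewrite Exy fy ltnNge H => /(_ isT).
Qed.

(** * The superization operator *)

Lemma incr_step n (v : {ffun 'I_n -> nat}) :
  (forall x y : 'I_n, y = x.+1 :> nat -> (v x <= v y)%N) -> incr v.
Proof.
move=> h; apply/incrP => x y; move: {2}(y - x)%N (erefl (y - x)%N) => m.
elim: m y => [|m IH] y E lexy.
  by have -> : y = x by apply: val_inj => /=; lia.
have lt : (y.-1 < n)%N by have := ltn_ord y; lia.
apply: (@leq_trans (v (Ordinal lt))); last by apply: h => /=; lia.
by apply: IH => /=; lia.
Qed.

(* Refines the order of the letters: equal letters are ordered by level, from
   the largest level to level 0. *)
Definition spread n k (i : {ffun 'I_n -> nat}) (t : {ffun 'I_n -> 'I_k.+1}) :
    {ffun 'I_n -> nat} := [ffun j => (i j * k.+1 + (k - t j))%N].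

Lemma spread_div n k (i : {ffun 'I_n -> nat}) (t : {ffun 'I_n -> 'I_k.+1}) j :
  (spread i t j %/ k.+1)%N = i j.
Proof. by rewrite ffunE divnMDl // divn_small ?addn0 // ltnS leq_subr. Qed.

Lemma spread_lt n k (i : {ffun 'I_n -> nat}) (t : {ffun 'I_n -> 'I_k.+1}) x y :
  (i x < i y)%N -> (spread i t x < spread i t y)%N.
Proof.
move=> lt; rewrite ltnNge; apply/negP => /(leq_div2r k.+1).
by rewrite !spread_div leqNgt lt.
Qed.

Lemma spread_eq_lt n k (i : {ffun 'I_n -> nat}) (t : {ffun 'I_n -> 'I_k.+1}) x y :
  i x = i y -> (spread i t x < spread i t y)%N = (t y < t x)%N.
Proof.
move=> e; rewrite !ffunE e ltn_add2l.
by have := ltn_ord (t x); have := ltn_ord (t y); rewrite !ltnS; lia.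
Qed.

Lemma spread_eq_le n k (i : {ffun 'I_n -> nat}) (t : {ffun 'I_n -> 'I_k.+1}) x y :
  i x = i y -> (spread i t x <= spread i t y)%N = (t y <= t x)%N.
Proof. by move=> e; rewrite leqNgt spread_eq_lt // -leqNgt. Qed.

(** [spread] keeps the strict order of distinct letters, and on equal letters it reverses the order
    of the levels, which is what [level_rel] encodes. *)
Lemma spread_chained n k (A : {set 'I_n}) (v : {ffun 'I_n -> nat})
    (t : {ffun 'I_n -> 'I_k.+1}) :
  incr (spread v t) && strict_at A (spread v t) =
  incr v && chained (fun i => @level_rel k (gap_of A v i)) t.
Proof.
apply/andP/andP => -[].
  move=> /incrP iu /strict_atP su; split.
    by apply/incrP => x y /iu/(leq_div2r k.+1); rewrite !spread_div.
  apply/forallP => x; apply/forallP => y; apply/implyP => /eqP E.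
  rewrite (gap_ofE _ _ E); case: eqP => // Ev.
  have := iu x y; rewrite E (spread_eq_le _ Ev) => /(_ (leqnSn _)) lt.
  by case: ifP => //= xA; have := su _ _ E xA; rewrite (spread_eq_lt _ Ev).
move=> /incrP iv /forallP ch.
have {}ch (x y : 'I_n) : y = x.+1 :> nat -> v x = v y ->
    if x \in A then (t y < t x)%N else (t y <= t x)%N.
  move=> E Ev; have /forallP/(_ y) := ch x; rewrite E eqxx /=.
  by rewrite (gap_ofE _ _ E) Ev eqxx; case: ifP.
have lt (x y : 'I_n) : y = x.+1 :> nat -> v x <> v y -> (v x < v y)%N.
  by move=> E /eqP ne; rewrite ltn_neqAle ne iv // E.
split.
  apply: incr_step => x y E; case: (v x =P v y) => [Ev|ne].
    by rewrite spread_eq_le //; have := ch _ _ E Ev; case: ifP => // _ /ltnW.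
  by rewrite ltnW // spread_lt // lt.
apply/strict_atP => x y E xA; case: (v x =P v y) => [Ev|ne].
  by rewrite spread_eq_lt //; have := ch _ _ E Ev; rewrite xA.
by rewrite spread_lt // lt.
Qed.

(** The extrapolation to k = -1 is cut off at order [n], so that the expression is defined and
    linear in [f] even where the inner sum is not polynomial in [k]. *)
Definition Theta0_at (f : ncseries) n (i : {ffun 'I_n -> nat}) : rat :=
  at_minus1 n (fun k => \sum_(t : {ffun 'I_n -> 'I_k.+1})
    (\prod_j level_weight (t j)) * f (word (spread i t))).

Definition Theta0 (f : ncseries) : ncseries :=
  fun w => Theta0_at f (letters (size w) w).

Lemma Theta0_word f n (i : {ffun 'I_n -> nat}) :
  Theta0 f (word i) = Theta0_at f i.
Proof.
suff H w : size w = n -> Theta0 f w = Theta0_at f (letters n w).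
  by rewrite H ?size_word // wordK.
by move=> <-.
Qed.

Lemma homog_Theta0 n f : homog n f -> homog n (Theta0 f).
Proof.
move=> hf w sw; apply: at_minus1_0 => k; apply: big1 => t _.
by rewrite hf ?mulr0 // size_word.
Qed.

Lemma Theta0_linear a f g : Theta0 (a *: f + g) = a *: Theta0 f + Theta0 g.
Proof.
apply/funext => w; rewrite !fctE /Theta0 /Theta0_at -[_ *: _]/(_ * _).
rewrite -at_minus1Z -at_minus1D; apply: eq_at_minus1 => k.
rewrite big_distrr -big_split; apply: eq_bigr => t _ /=.
by rewrite -[_ *: _]/(_ * _); ring.
Qed.

Lemma pull_spread n k (s : 'S_n) i (t : {ffun 'I_n -> 'I_k.+1}) :
  pull s (spread i t) = spread (pull s i) [ffun x => t (s x)].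
Proof. by apply/ffunP => x; rewrite !ffunE. Qed.

Lemma Theta0_F_word n (A : {set 'I_n}) (s : 'S_n) i :
  Theta0 (nc_F A s) (word i) = if incr (pull s i) then
    \sum_(e : {ffun 'I_n -> bool})
      (chained (fun k => sign_rel (gap_of A (pull s i) k)) e)%:R else 0.
Proof.
rewrite Theta0_word /Theta0_at.
pose v := pull s i.
rewrite (eq_at_minus1 _ (g := fun k => (incr v)%:R *
    \sum_(t : {ffun 'I_n -> 'I_k.+1}) (\prod_j level_weight (t j)) *
      (chained (fun j => @level_rel k (gap_of A v j)) t)%:R)) => [|k].
  by rewrite at_minus1Z at_minus1_chain /v; case: incr;
    rewrite ?mul1r ?mul0r.
(* Levels are indexed by the positions in the word; [h] lets them be indexed by the positions in the
   sorted word. *)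
pose h (t : {ffun 'I_n -> 'I_k.+1}) : {ffun 'I_n -> 'I_k.+1} :=
  [ffun x => t ((s^-1)%g x)].
rewrite (reindex h) /=; last first.
  exists (fun t : {ffun 'I_n -> 'I_k.+1} => [ffun x => t (s x)]) => t _;
    by apply/ffunP => x; rewrite !ffunE ?permK ?permKV.
rewrite big_distrr; apply: eq_bigr => t _ /=.
rewrite nc_F_word pull_spread.
have -> : [ffun x => h t (s x)] = t.
  by apply/ffunP => x; rewrite !ffunE permK.
rewrite spread_chained -/v -mulnb natrM mulrCA; congr (_ * (_ * _)).
rewrite (reindex_inj (@perm_inj _ s)) /=; apply: eq_bigr => x _.
by rewrite ffunE permK.
Qed.

(** An element i+1 of [A] whose predecessor is not in [A] is exactly an element i+1 of
    [peak_part A]. Hence the clashing pairs of gaps see [A] only through its peak part. *)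
Lemma gap_peak n (A : {set 'I_n}) (v : {ffun 'I_n -> nat}) i :
  (gap_of A v i = Weak /\ gap_of A v i.+1 = Strict) <->
  [&& (i.+2 < n)%N, nth 0%N (word v) i == nth 0%N (word v) i.+1,
      nth 0%N (word v) i.+1 == nth 0%N (word v) i.+2
    & [exists y in peak_part A, y == i.+1 :> nat]].
Proof.
have E : [exists y in peak_part A, y == i.+1 :> nat] =
   [exists a in A, a == i.+1 :> nat] && ~~ [exists a in A, a == i :> nat].
  apply/existsP/andP.
    move=> [y]; rewrite !inE negb_or => /andP[/andP[/andP[na _] yA] /eqP e].
    split; first by apply/existsP; exists y; rewrite yA e eqxx.
    apply: contra na => /existsP[a /andP[aA /eqP ea]].
    by apply/existsP; exists a; rewrite aA e ea eqxx.
  move=> [/existsP[y /andP[yA /eqP e]] na]; exists y.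
  rewrite !inE e yA eqxx !andbT /= orbF.
  apply: contra na => /existsP[a /andP[aA /eqP ea]].
  by apply/existsP; exists a; rewrite aA -eqSS ea eqxx.
rewrite E /gap_of; case: (ltnP i.+2 n) => lt; last by rewrite andFb; split => // -[].
have -> : (i.+1 < n)%N by exact: ltnW.
rewrite /=; do 2 case: eqP => _ /=; try by split => // -[].
case: [exists a in A, a == i.+1 :> nat];
  case: [exists a in A, a == i :> nat] => /=; by split => // -[].
Qed.

Lemma Peak_Des n (g : 'S_n) : Peak g = peak_part (Des g).
Proof.
apply/setP => x; rewrite !inE negb_or; apply/existsP/andP.
  move=> [h /existsP[j /and4P[/eqP eh /eqP ej lth ltj]]]; split; last first.
    by apply/existsP; exists j; rewrite ej eqxx.
  rewrite eh andbT; apply/negP => /existsP[a /andP[aD /eqP e]].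
  have {e}ea : a = h by apply: val_inj; move: e => /= [].
  by move: aD; rewrite ea (mem_DesE _ eh) ltnNge ltnW.
move=> [/andP[na x0] /existsP[j /andP[/eqP ej ltj]]].
have lt : (x.-1 < n)%N by have := ltn_ord x; lia.
have eh : x = (Ordinal lt).+1 :> nat by rewrite /= prednK // lt0n.
exists (Ordinal lt); apply/existsP; exists j.
rewrite ej ltj -eh !eqxx !andbT /= ltn_neqAle; apply/andP; split.
  by apply/eqP => /val_inj/perm_inj e; move: eh; rewrite e; lia.
rewrite leqNgt; apply: contra na => ltg; apply/existsP; exists (Ordinal lt).
by rewrite (mem_DesE _ eh) ltg -eh /=.
Qed.

(* The product of the transpositions (b, b + 1) for b in B. *)
Lemma peak_set_realizable n (A : {set 'I_n}) :
  (forall i, i \in A -> (i.+1 < n)%N) ->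
  exists g : 'S_n, Peak g = peak_part A.
Proof.
move=> ltA; pose B := peak_part A.
have B0 (x : 'I_n) : x \in B -> (0 < x)%N.
  by rewrite !inE negb_or lt0n => /andP[/andP[]].
have Bn (x : 'I_n) : x \in B -> (x.+1 < n)%N.
  by rewrite inE => /andP[_ /ltA].
have BS (x y : 'I_n) : x \in B -> y = x.+1 :> nat -> y \notin B.
  rewrite inE => /andP[_ xA] e; rewrite !inE; apply/negP => /andP[/negP + _]; apply.
  by apply/orP; left; apply/existsP; exists x; rewrite xA e eqxx.
pose b (x : nat) := [exists y in B, y == x :> nat].
have bE (x : 'I_n) : b x = (x \in B).
  apply/existsP/idP => [[y /andP[yB /eqP/val_inj <-]] //|xB].
  by exists x; rewrite xB eqxx.
(* [d] exchanges each element of [B] with its successor; it is an involution because [B] has no two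
   consecutive elements. *)
pose d (x : nat) := if b x then x.+1 else if (0 < x)%N && b x.-1 then x.-1 else x.
have bS x : b x -> ~~ b x.+1.
  move=> /existsP[y /andP[yB /eqP <-]]; apply/negP => /existsP[z /andP[zB /eqP e]].
  by move: (BS _ _ yB e); rewrite zB.
have bn x : b x -> (x.+1 < n)%N by move=> /existsP[y /andP[/Bn + /eqP <-]].
have dn (x : 'I_n) : (d x < n)%N.
  rewrite /d; case: ifP => [/bn //|_]; have := ltn_ord x.
  by case: ifP => // _; lia.
have dK x : d (d x) = x.
  rewrite {2}/d; case: ifP => bx.
    by rewrite /d (negbTE (bS _ bx)) /= bx.
  case: ifP => [/andP[x0 bx1]|nb]; last by rewrite /d bx nb.
  by rewrite /d bx1 prednK.
pose G (x : 'I_n) := Ordinal (dn x).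
have Ginj : injective G.
  by move=> x y /(congr1 val)/= e; apply: val_inj; rewrite /= -(dK x) e dK.
exists (perm Ginj); rewrite Peak_Des.
have -> : Des (perm Ginj) = B.
  apply/setP => x; rewrite inE; apply/existsP/idP.
    move=> [y /andP[/eqP e]]; rewrite !permE /= -bE.
    case: (boolP (b x)) => // nb; rewrite /d (negbTE nb) e /= (negbTE nb).
    by case: ifP; case: ifP; lia.
  move=> xB; exists (Ordinal (Bn _ xB)); rewrite eqxx !permE /= /d bE xB /=.
  by rewrite (negbTE (bS _ _)) ?bE // xB.
(* [B] has no consecutive elements and avoids 0, so it is its own peak part. *)
apply/setP => x; rewrite inE; case: (boolP (x \in B)) => xB; rewrite ?andbF ?andbT //.
rewrite !inE negb_or -lt0n B0 // andbT; apply/negP => /existsP[a /andP[aB /eqP e]].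
by move: (BS _ _ aB e); rewrite xB.
Qed.

(** The [Free] gaps depend on the word alone and the clashing pairs on the word and the peaks, so
    [A] and the descent set of [g] admit equally many sign patterns. This also shows that the choice
    behind [Theta_NCQSym] succeeds. *)
Lemma Theta0_is_Theta : is_Theta Theta0.
Proof.
split=> [a u v _ _|n A s ltA _]; first exact: Theta0_linear.
rewrite /nc_Kpeak; case: pickP => [g /eqP Eg|no]; last first.
  by have [g Eg] := peak_set_realizable ltA; have := no g; rewrite Eg eqxx.
apply: (homog_ext (n := n)); [exact/homog_Theta0/homog_F|exact: homog_K|].
move=> i; rewrite Theta0_F_word nc_K_word; case: incr => //.
apply: sum_chained_sign => k.
  rewrite /gap_of; case: (_ && _) => //.
  by split; case: ifP.
by rewrite !gap_peak -Eg Peak_Des.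
Qed.

Lemma Theta_NCQSymP : is_Theta Theta_NCQSym.
Proof. by apply: xgetPex; exists Theta0; exact: Theta0_is_Theta. Qed.

(** * Linear spans and triangular systems *)

Definition lin_closed (V : lmodType rat) (P : V -> Prop) : Prop :=
  P 0 /\ forall a u v, P u -> P v -> P (a *: u + v).

Section LinClosed.
Context (V : lmodType rat) (P : V -> Prop) (closedP : lin_closed P).

Lemma lin_closedZ a u : P u -> P (a *: u).
Proof.
by case: closedP => P0 PD Pu; rewrite -[_ *: _]addr0; apply: PD.
Qed.

Lemma lin_closedD u v : P u -> P v -> P (u + v).
Proof. by case: closedP => P0 PD Pu Pv; rewrite -[u]scale1r; apply: PD. Qed.

Lemma lin_closedB u v : P u -> P v -> P (u - v).
Proof.
by move=> Pu Pv; apply: lin_closedD => //; rewrite -scaleN1r; apply: lin_closedZ.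
Qed.

Lemma lin_closed_sum (I : Type) (r : seq I) (Q : pred I) (F : I -> V) :
  (forall i, Q i -> P (F i)) -> P (\sum_(i <- r | Q i) F i).
Proof.
move=> PF; elim/big_rec: _ => [|i u Qi Pu]; first by case: closedP.
by apply: lin_closedD; [apply: PF|].
Qed.

(** Solve the equation of [i] for [M i]: every other term that occurs has smaller rank, so induction
    applies to it, and the diagonal coefficient can be divided out. *)
Lemma triangular_closed (I : finType) (G : pred I) (rank : I -> nat)
    (a : I -> I -> rat) (F M : I -> V) :
  (forall i, G i -> P (F i)) ->
  (forall i, G i -> F i = \sum_(j | G j) a i j *: M j) ->
  (forall i, G i -> a i i != 0) ->
  (forall i j, G i -> G j -> a i j != 0 -> j != i -> (rank j < rank i)%N) ->
  forall i, G i -> P (M i).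
Proof.
move=> PF FE aii aij i; have [m] := ubnP (rank i).
elim: m i => // m IH i lt Gi.
have := FE i Gi; rewrite (bigD1 i) //= => /esym/(canRL (addrK _)) E.
rewrite -[M i](scalerK (aii i Gi)) E; apply/lin_closedZ/lin_closedB.
  exact: PF.
apply: lin_closed_sum => j /andP[Gj ne].
have [->|nz] := eqVneq (a i j) 0; first by rewrite scale0r; case: closedP.
by apply/lin_closedZ/IH => //; apply: leq_trans (aij i j Gi Gj nz ne) _.
Qed.

End LinClosed.

Lemma span_gen (S : set ncseries) f : S f -> span S f.
Proof.
by move=> Sf; exists 1%N, (fun=> 1), (fun=> f); rewrite big_ord1 scale1r.
Qed.

Lemma span_lin_closed (S : set ncseries) : lin_closed (span S).
Proof.
split=> [|a u v [k [c [g [Sg ->]]]] [l [d [h [Sh ->]]]]].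
  by exists 0%N, (fun=> 0), (fun=> 0); rewrite big_ord0; split=> // -[].
exists (k + l)%N,
  (fun i => match fintype.split i with inl x => a * c x | inr y => d y end),
  (fun i => match fintype.split i with inl x => g x | inr y => h y end).
split=> [i|]; first by case: fintype.split.
rewrite big_split_ord /= scaler_sumr; congr (_ + _); apply: eq_bigr => i _.
  by rewrite (unsplitK (inl i)) scalerA.
by rewrite (unsplitK (inr i)).
Qed.

Lemma span_closed (S : set ncseries) (P : ncseries -> Prop) f :
  lin_closed P -> (forall g, S g -> P g) -> span S f -> P f.
Proof.
move=> cP SP [k [c [g [Sg ->]]]]; apply: (lin_closed_sum cP) => i _.
by apply: (lin_closedZ cP); apply: SP.
Qed.

(** * Quasi-symmetric expansions *)

Definition ordeq n (i i' : {ffun 'I_n -> nat}) : Prop :=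
  forall j k, (i j < i k)%N = (i' j < i' k)%N.

Definition qsym n (f : ncseries) : Prop :=
  homog n f /\
  forall i i' : {ffun 'I_n -> nat}, ordeq i i' -> f (word i) = f (word i').

Lemma ordeq_le n (i i' : {ffun 'I_n -> nat}) :
  ordeq i i' -> forall j k, (i j <= i k)%N = (i' j <= i' k)%N.
Proof. by move=> e j k; rewrite leqNgt e -leqNgt. Qed.

Lemma ordeq_eq n (i i' : {ffun 'I_n -> nat}) :
  ordeq i i' -> forall j k, (i j == i k) = (i' j == i' k).
Proof. by move=> e j k; rewrite !eqn_leq !(ordeq_le e). Qed.

Definition steps n (v : {ffun 'I_n -> nat}) : {set 'I_n} :=
  [set x : 'I_n | [exists y : 'I_n, (y == x.+1 :> nat) && (v x < v y)%N]].

Lemma mem_steps n (v : {ffun 'I_n -> nat}) (x y : 'I_n) :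
  y = x.+1 :> nat -> (x \in steps v) = (v x < v y)%N.
Proof.
move=> e; rewrite inE; apply/existsP/idP => [[z /andP[/eqP ez]]|lt].
  by have -> // : z = y by apply: val_inj; rewrite /= ez e.
by exists y; rewrite e eqxx.
Qed.

Definition sorted_by n (D : {set 'I_n}) (s : 'S_n) (i : {ffun 'I_n -> nat}) :=
  incr (pull s i) && (steps (pull s i) == D).

(* M_phi for the set composition phi of the consecutive runs of s cut at D *)
Definition nc_Mcut n (D : {set 'I_n}) (s : 'S_n) : ncseries :=
  fun w => ((size w == n) && sorted_by D s (letters n w))%:R.

Lemma homog_Mcut n (D : {set 'I_n}) s : homog n (nc_Mcut D s).
Proof. by move=> w /eqP/negbTE sw; rewrite /nc_Mcut sw. Qed.

Lemma nc_Mcut_word n (D : {set 'I_n}) s i :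
  nc_Mcut D s (word i) = (sorted_by D s i)%:R.
Proof. by rewrite /nc_Mcut size_word eqxx wordK. Qed.

(** For a weakly increasing function, a strict inequality between two values means that a step lies
    between their positions. *)
Lemma incr_steps_lt n (v v' : {ffun 'I_n -> nat}) (x y : 'I_n) :
  incr v -> incr v' -> steps v \subset steps v' ->
  (v x < v y)%N -> (v' x < v' y)%N.
Proof.
move=> /incrP iv /incrP iv' /fintype.subsetP sub.
move: {2}(y - x)%N (erefl (y - x)%N) => m.
elim: m y => [|m IH] y E lt.
  have : (y <= x)%N by lia.
  by move=> /iv; rewrite leqNgt lt.
have ltz : (y.-1 < n)%N by have := ltn_ord y; lia.
pose z := Ordinal ltz; have Ez : y = z.+1 :> nat by rewrite /=; lia.
case: (ltnP (v z) (v y)) => [lt'|le].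
  have : z \in steps v' by apply: sub; rewrite (mem_steps _ Ez).
  by rewrite (mem_steps _ Ez); apply: leq_ltn_trans; apply: iv' => /=; lia.
apply: (@leq_trans (v' z)); last by apply: iv'; rewrite Ez.
by apply: IH => /=; [lia|apply: leq_trans lt le].
Qed.

(** A weakly increasing function is determined by its steps up to order equivalence, so the words
    sorted by [D] and [s] fill one order class. *)
Lemma sorted_by_ordeq n (D : {set 'I_n}) (s : 'S_n) i i' :
  sorted_by D s i -> sorted_by D s i' <-> ordeq i i'.
Proof.
move=> /andP[iv /eqP sv]; split=> [/andP[iv' /eqP sv'] j k|e].
  have H (u u' : {ffun 'I_n -> nat}) : incr (pull s u) -> incr (pull s u') ->
      steps (pull s u) \subset steps (pull s u') ->
      (u j < u k)%N -> (u' j < u' k)%N.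
    move=> iu iu' su lt.
    have := @incr_steps_lt _ _ _ ((s^-1)%g j) ((s^-1)%g k) iu iu' su.
    by rewrite !ffunE !permKV => /(_ lt).
  by apply/idP/idP; apply: H; rewrite ?sv ?sv'.
apply/andP; split.
  apply/incrP => x y le; rewrite !ffunE -(ordeq_le e).
  by have /incrP/(_ x y le) := iv; rewrite !ffunE.
rewrite -sv; apply/eqP/setP => x; rewrite !inE; apply: eq_existsb => y.
by rewrite !ffunE e.
Qed.

Definition runs n (i : {ffun 'I_n -> nat}) : seq {set 'I_n} :=
  [seq [set j | i j == v] | v <- sort leq (undup (word i))].

Lemma mem_word n (i : {ffun 'I_n -> nat}) j : i j \in word i.
Proof. by apply/mapP; exists j => //; rewrite mem_enum. Qed.

Lemma runs_composition n (i : {ffun 'I_n -> nat}) : set_composition (runs i).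
Proof.
apply/andP; split.
  rewrite map_inj_in_uniq ?sort_uniq ?undup_uniq // => u v.
  rewrite mem_sort mem_undup => /mapP[j _ ->] _ /setP/(_ j).
  by rewrite !inE eqxx => /esym/eqP.
have -> : [set B in runs i] = preim_partition i [set: 'I_n].
  apply/setP => B; rewrite inE; apply/mapP/imsetP.
    move=> [v]; rewrite mem_sort mem_undup => /mapP[j _ ->] ->; exists j => //.
    by apply/setP => k; rewrite !inE eq_sym.
  move=> [j _ ->]; exists (i j); first by rewrite mem_sort mem_undup mem_word.
  by apply/setP => k; rewrite !inE eq_sym.
exact: preim_partitionP.
Qed.

Lemma block_index_runs n (i : {ffun 'I_n -> nat}) j :
  block_index (runs i) j = index (i j) (sort leq (undup (word i))).
Proof.
rewrite /block_index /runs find_map /index; apply: eq_find => v /=.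
by rewrite inE eq_sym.
Qed.

Lemma index_sorted_lt (l : seq nat) x y : uniq l -> sorted leq l ->
  x \in l -> y \in l -> (index x l < index y l)%N = (x < y)%N.
Proof.
move=> ul sl xl yl; have sl' : sorted ltn l by rewrite ltn_sorted_uniq_leq ul.
apply/idP/idP => [|lt]; first exact: (sorted_ltn_index ltn_trans sl').
rewrite ltnNge; apply/negP => /(sorted_leq_index leq_trans leqnn sl _ _ yl xl).
by rewrite leqNgt lt.
Qed.

Lemma nc_M_runs n (i i' : {ffun 'I_n -> nat}) :
  nc_M (runs i) (word i') = `[< ordeq i i' >]%:R.
Proof.
rewrite /nc_M ncsum_inj; last exact: can_inj (@wordK n).
set P := (X in `[< X >]); suff -> : `[< P >] = `[< ordeq i i' >].
  by case: `[< _ >].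
have lt j k : (block_index (runs i) j < block_index (runs i) k)%N =
    (i j < i k)%N.
  rewrite !block_index_runs index_sorted_lt ?sort_uniq ?undup_uniq
    ?mem_sort ?mem_undup ?mem_word //.
  by apply: sort_sorted; apply: leq_total.
have le j k : (block_index (runs i) j <= block_index (runs i) k)%N =
    (i j <= i k)%N by rewrite leqNgt lt -leqNgt.
apply: asbool_equiv_eq; split=> [H j k|e j k].
  by rewrite -lt; apply/idP/idP => /(proj2 (H j k)).
rewrite lt e; split=> //; split=> [E|E]; apply/eqP.
  by rewrite eqn_leq !le !(ordeq_le e) E leqnn.
by rewrite eqn_leq -!(ordeq_le e) -!le E leqnn.
Qed.

Lemma homog_M n (phi : seq {set 'I_n}) : homog n (nc_M phi).
Proof. by apply: homog_ncsum => f; rewrite size_word. Qed.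

Lemma NCQSym_Mcut n (D : {set 'I_n}) s : NCQSym (nc_Mcut D s).
Proof.
have [[i si]|no] := pselect (exists i, sorted_by D s i).
  apply: span_gen; exists n, (runs i); split; first exact: runs_composition.
  apply: (homog_ext (homog_Mcut _ _) (homog_M _)) => i'.
  rewrite nc_Mcut_word nc_M_runs; congr (nat_of_bool _)%:R.
  by apply/idP/asboolP => /(sorted_by_ordeq i' si).
have -> : nc_Mcut D s = 0.
  apply: (homog_ext (homog_Mcut D s) (@homog0 n)) => i.
  rewrite nc_Mcut_word; case: (boolP (sorted_by _ _ _)) => // si.
  by case: no; exists i.
by have [] := span_lin_closed [set f | exists n phi,
  @set_composition n phi /\ f = nc_M phi]%classic.
Qed.

(** The pairs for which [is_Theta] prescribes the image of [nc_F D s]. *)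
Definition cut n (s : 'S_n) (D : {set 'I_n}) : bool :=
  (Des s \subset D) && [forall i in D, (i.+1 < n)%N].

Lemma steps_lt n (v : {ffun 'I_n -> nat}) x : x \in steps v -> (x.+1 < n)%N.
Proof. by rewrite inE => /existsP[y /andP[/eqP <- _]]. Qed.

(** The functions counted by F are sorted by their exact set of steps, which contains [A] and hence
    the descents of [s]. *)
Lemma nc_F_sum n (A : {set 'I_n}) s : cut s A ->
  nc_F A s = \sum_(D | cut s D) (A \subset D)%:R *: nc_Mcut D s.
Proof.
move=> /andP[dA /forall_inP ltA].
apply: homog_ext => [||i]; first exact: homog_F.
  by apply: homog_sum => D _; apply/homogZ/homog_Mcut.
rewrite nc_F_word sum_apply.
rewrite (eq_bigr (fun D : {set 'I_n} => (A \subset D)%:R * (sorted_by D s i)%:R));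
  last by move=> D _; rewrite -nc_Mcut_word.
rewrite /sorted_by; set v := pull s i; case: (incr v) => /=; last first.
  by rewrite big1 // => D _; rewrite mulr0.
have -> : strict_at A v = (A \subset steps v).
  apply/strict_atP/fintype.subsetP => [h x xA|h x y e xA].
    by rewrite (mem_steps v (y := Ordinal (ltA _ xA))) //; apply: h.
  by rewrite -(mem_steps _ e) h.
case: (boolP (A \subset steps v)) => sub.
  have cv : cut s (steps v).
    rewrite /cut (fintype.subset_trans dA) //=.
    by apply/forall_inP => x; apply: steps_lt.
  rewrite (bigD1 (steps v)) //= sub eqxx mulr1 big1 ?addr0 // => D /andP[_ ne].
  by rewrite eq_sym (negbTE ne) mulr0.
rewrite big1 // => D _; case: eqP => [<-|_]; last by rewrite mulr0.
by rewrite (negbTE sub) mul0r.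
Qed.

Lemma NCQSym_F n (A : {set 'I_n}) s : cut s A -> NCQSym (nc_F A s).
Proof.
move=> cA; rewrite nc_F_sum //; apply: lin_closed_sum => [|D _].
  exact: span_lin_closed.
by apply: lin_closedZ; [exact: span_lin_closed|exact: NCQSym_Mcut].
Qed.

Lemma linear_on0 (S : set ncseries) T : linear_on S T -> S 0 -> T 0 = 0.
Proof.
move=> lT S0; have := lT 1 0 0 S0 S0; rewrite !scale1r addr0.
by move=> /esym/(canRL (addrK _)); rewrite subrr.
Qed.

(** Membership is recorded because the linearity of [Theta_NCQSym] is specified on [NCQSym] only. *)
Definition Theta_agrees (f : ncseries) : Prop :=
  NCQSym f /\ Theta_NCQSym f = Theta0 f.

Lemma Theta_agrees_closed : lin_closed Theta_agrees.
Proof.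
have [cS0 cSD] := span_lin_closed [set f | exists n phi,
  @set_composition n phi /\ f = nc_M phi]%classic.
have [lT _] := Theta_NCQSymP; have [lT0 _] := Theta0_is_Theta.
split=> [|a u v [Su eu] [Sv ev]].
  by split=> //; rewrite (linear_on0 lT) // (linear_on0 lT0).
by split; [exact: cSD|rewrite lT // lT0 // eu ev].
Qed.

(** Both operators have the prescribed values on F, and the expansion of F over supersets is
    triangular for inclusion, the larger sets having the smaller rank. *)
Lemma Theta_agrees_Mcut n (D : {set 'I_n}) s :
  cut s D -> Theta_agrees (nc_Mcut D s).
Proof.
have [_ FT] := Theta_NCQSymP; have [_ FT0] := Theta0_is_Theta.
move: D; apply: (triangular_closed Theta_agrees_closed (G := cut s)
  (rank := fun D : {set 'I_n} => (n - #|D|)%N)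
  (a := fun A D : {set 'I_n} => (A \subset D)%:R) (F := fun A => nc_F A s)).
- move=> A cA; split; first exact: NCQSym_F.
  by move: cA => /andP[dA /forall_inP ltA]; rewrite FT // FT0.
- by move=> A; apply: nc_F_sum.
- by move=> A _; rewrite subxx oner_eq0.
- move=> A D _ _; case: (boolP (A \subset D)) => // sub _ ne.
  have : (#|A| < #|D|)%N by apply: proper_card; rewrite finset.properEneq eq_sym ne.
  have : (#|D| <= n)%N by rewrite -[X in (_ <= X)%N]card_ord max_card.
  by lia.
Qed.

(** * The stable sorting permutation *)

Definition lexlt n (i : {ffun 'I_n -> nat}) (j k : 'I_n) : bool :=
  (i j < i k)%N || (i j == i k) && (j < k)%N.

Definition lexrank n (i : {ffun 'I_n -> nat}) (j : 'I_n) : nat :=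
  #|[set k | lexlt i k j]|.

Lemma lexlt_trans n (i : {ffun 'I_n -> nat}) : transitive (lexlt i).
Proof. by move=> y x z; rewrite /lexlt; lia. Qed.

Lemma lexlt_irr n (i : {ffun 'I_n -> nat}) x : lexlt i x x = false.
Proof. by rewrite /lexlt; lia. Qed.

Lemma lexlt_total n (i : {ffun 'I_n -> nat}) x y :
  [|| lexlt i x y, x == y | lexlt i y x].
Proof. by rewrite /lexlt -val_eqE /=; lia. Qed.

Lemma lexrank_lt n (i : {ffun 'I_n -> nat}) x y :
  lexlt i x y -> (lexrank i x < lexrank i y)%N.
Proof.
move=> lt; apply: proper_card; apply/properP; split.
  by apply/fintype.subsetP => k; rewrite !inE => /lexlt_trans; apply.
by exists x; rewrite inE // lexlt_irr.
Qed.

Lemma lexrank_inj n (i : {ffun 'I_n -> nat}) : injective (lexrank i).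
Proof.
move=> x y e; have /or3P[/lexrank_lt|/eqP //|/lexrank_lt] := lexlt_total i x y;
  by rewrite e ltnn.
Qed.

Definition lexsorted n (i : {ffun 'I_n -> nat}) (s : 'S_n) : Prop :=
  forall x y : 'I_n, (x < y)%N -> lexlt i (s x) (s y).

Lemma lexsorted_uniq n (i : {ffun 'I_n -> nat}) (s r : 'S_n) :
  lexsorted i s -> lexsorted i r -> s = r.
Proof.
(* The positions listed before [t x] are exactly the lexicographically smaller ones, so the rank of
   [t x] determines it. *)
suff H (t : 'S_n) x : lexsorted i t -> lexrank i (t x) = #|[set y : 'I_n | y < x]%N|.
  by move=> ls lr; apply/permP => x; apply: (@lexrank_inj _ i); rewrite !H.
move=> lt; rewrite -(card_imset _ (@perm_inj _ t)); congr #|pred_of_set _|.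
apply/setP => k; rewrite inE; apply/idP/imsetP => [h|[y + ->]]; last first.
  by rewrite inE; apply: lt.
exists ((t^-1)%g k); last by rewrite permKV.
rewrite inE ltnNge leq_eqVlt; apply/norP; split.
  by apply: contraTneq h => /val_inj->; rewrite permKV lexlt_irr.
apply/negP => /lt; rewrite permKV => /(lexlt_trans h).
by rewrite lexlt_irr.
Qed.

Lemma lexsorted_exists n (i : {ffun 'I_n -> nat}) : exists s, lexsorted i s.
Proof.
have lt j : (lexrank i j < n)%N.
  rewrite -[X in (_ < X)%N](card_ord n) -cardsT; apply: proper_card.
  by apply/properP; split=> //; exists j; rewrite ?inE ?lexlt_irr.
pose R j := Ordinal (lt j).
have Rinj : injective R by move=> j k [/lexrank_inj].
exists ((perm Rinj)^-1)%g => x y ltxy.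
have rk z : lexrank i (((perm Rinj)^-1)%g z) = z.
  by have /(congr1 val) := permKV (perm Rinj) z; rewrite permE.
have /or3P[//|/eqP/perm_inj e|/lexrank_lt] := lexlt_total i
  (((perm Rinj)^-1)%g x) (((perm Rinj)^-1)%g y).
  by move: ltxy; rewrite e ltnn.
by rewrite !rk ltnNge ltnW.
Qed.

(** Between equal letters there is no step, hence no element of [D] and no descent of [s]: [s]
    increases along each run. So a word determines [s], and then [D]. *)
Lemma sorted_by_lexsorted n (D : {set 'I_n}) (s : 'S_n) i :
  cut s D -> sorted_by D s i -> lexsorted i s.
Proof.
move=> /andP[/fintype.subsetP dD _] /andP[/incrP iv /eqP sv] x y lt.
rewrite /lexlt; have := iv x y (ltnW lt); rewrite !ffunE leq_eqVlt orbC.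
move=> /orP[->//|/eqP E]; rewrite E eqxx ltnn /=.
move: {2}(y - x)%N (erefl (y - x)%N) E lt => m.
elim: m y => [|m IH] y E Exy lt; first by lia.
have ltz : (y.-1 < n)%N by have := ltn_ord y; lia.
pose z := Ordinal ltz; have Ez : y = z.+1 :> nat by rewrite /=; lia.
have szy : i (s z) = i (s y) -> (s z < s y)%N.
  move=> e; have : z \notin D by rewrite -sv (mem_steps _ Ez) !ffunE e ltnn.
  move=> /(contra (dD z)); rewrite (mem_DesE _ Ez) -leqNgt leq_eqVlt.
  by move=> /orP[/eqP/val_inj/perm_inj ezy|//]; move: Ez; rewrite ezy; lia.
case: (ltngtP x z) => [ltxz| |/val_inj exz]; last by rewrite exz szy // -exz.
  have := iv x z (ltnW ltxz); have := iv z y; rewrite Ez leqnSn => /(_ isT).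
  rewrite !ffunE => le1 le2.
  have e : i (s x) = i (s z) by apply/eqP; rewrite eqn_leq le2 Exy.
  apply: ltn_trans (IH z _ e ltxz) (szy _); first by rewrite /=; lia.
  by rewrite -e.
by rewrite /=; lia.
Qed.

Lemma sorted_by_exists n (i : {ffun 'I_n -> nat}) :
  exists D s, cut s D /\ sorted_by D s i.
Proof.
have [s ls] := lexsorted_exists i; exists (steps (pull s i)), s.
split; last first.
  rewrite /sorted_by eqxx andbT; apply/incrP => x y; rewrite !ffunE leq_eqVlt.
  move=> /orP[/eqP/val_inj->//|/ls]; rewrite /lexlt.
  by move=> /orP[/ltnW//|/andP[/eqP->]].
apply/andP; split; last by apply/forall_inP => x; apply: steps_lt.
apply/fintype.subsetP => x; rewrite inE => /existsP[y /andP[/eqP e lt]].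
have := ls x y; rewrite e => /(_ (ltnSn _)); rewrite /lexlt (mem_steps _ e) !ffunE.
by move=> /orP[//|/andP[_]]; rewrite ltnNge ltnW.
Qed.

(** Every word is sorted by exactly one pair satisfying [cut], so a series constant on order classes
    is a finite combination of the [nc_Mcut]. *)
Lemma qsym_agrees n f : qsym n f -> Theta_agrees f.
Proof.
move=> [hf qf].
(* The coefficient of [f] at any word sorted by [p]; the default word is taken only when there is
   none, and then the series [nc_Mcut] is 0. *)
pose c (p : {set 'I_n} * 'S_n) :=
  f (word (xget [ffun=> 0%N] [set i | sorted_by p.1 p.2 i]%classic)).
have -> : f = \sum_(p | cut p.2 p.1) c p *: nc_Mcut p.1 p.2.
  apply: (homog_ext hf) => [|i].
    by apply: homog_sum => p _; apply/homogZ/homog_Mcut.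
  have [D [s [cD si]]] := sorted_by_exists i.
  rewrite sum_apply (bigD1 (D, s)) //= big1 => [|[E r] /= /andP[cE ne]].
    rewrite addr0 fctE nc_Mcut_word si [_ *: _]mulr1; apply: qf.
    apply/(sorted_by_ordeq _ si).
    by have := xgetPex [ffun=> 0%N] (P := [set i | sorted_by D s i]%classic);
      apply; exists i.
  rewrite fctE nc_Mcut_word; case: (boolP (sorted_by E r i)) => [ri|_].
    have ers := lexsorted_uniq (sorted_by_lexsorted cE ri)
      (sorted_by_lexsorted cD si); rewrite ers in ri ne.
    move: si ri ne => /andP[_ /eqP <-] /andP[_ /eqP <-].
    by rewrite eqxx.
  exact: scaler0.
apply: (lin_closed_sum Theta_agrees_closed) => p cp.
by apply: (lin_closedZ Theta_agrees_closed); apply: Theta_agrees_Mcut.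
Qed.

(** * Power sums and monomials *)

Section SamePartition.
Context (n : nat) (pi : {set {set 'I_n}}) (ppi : set_partition pi).

Lemma pblock_in j : finset.pblock pi j \in pi.
Proof. by apply: pblock_mem; rewrite (finset.cover_partition ppi) inE. Qed.

Lemma pblock_refl j : j \in finset.pblock pi j.
Proof. by rewrite mem_pblock (finset.cover_partition ppi) inE. Qed.

Lemma pblockE B j : B \in pi -> j \in B -> finset.pblock pi j = B.
Proof. by move=> Bpi jB; apply: def_pblock Bpi jB; case/and3P: ppi. Qed.

Lemma mem_blockE B j : B \in pi -> (j \in B) = (finset.pblock pi j == B).
Proof.
move=> Bpi; apply/idP/eqP => [|<-]; [exact: pblockE|exact: pblock_refl].
Qed.

Lemma same_blockE j k : same_block pi j k = (finset.pblock pi j == finset.pblock pi k).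
Proof.
apply/existsP/eqP => [[B /and3P[Bpi jB kB]]|e].
  by rewrite !(pblockE Bpi).
by exists (finset.pblock pi j); rewrite pblock_in pblock_refl e pblock_refl.
Qed.

Lemma card_set_partition : (#|pi| <= n)%N.
Proof.
rewrite -[X in (_ <= X)%N]card_ord -cardsT (card_partition ppi).
rewrite -[X in (X <= _)%N]sum1_card.
apply: leq_sum => B Bpi; rewrite card_gt0; exact: finset.partition_neq0 ppi Bpi.
Qed.

End SamePartition.

Lemma same_block_inj n (pi sg : {set {set 'I_n}}) :
  set_partition pi -> set_partition sg -> same_block pi =2 same_block sg ->
  pi = sg.
Proof.
move=> pp ps e; rewrite -(equivalence_partition_pblock pp).
rewrite -(equivalence_partition_pblock ps); apply: eq_imset => j.
apply/setP => k; rewrite !inE /= (mem_blockE pp _ (pblock_in pp j)).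
by rewrite (mem_blockE ps _ (pblock_in ps j)) !(eq_sym _ (finset.pblock _ j))
  -!same_blockE.
Qed.

Definition constb (T : eqType) n (pi : {set {set 'I_n}}) (i : {ffun 'I_n -> T}) :
    bool :=
  [forall j, forall k, same_block pi j k ==> (i j == i k)].

Lemma constbP (T : eqType) n (pi : {set {set 'I_n}}) (i : {ffun 'I_n -> T}) :
  reflect (forall j k, same_block pi j k -> i j = i k) (constb pi i).
Proof.
apply: (iffP forallP) => [h j k jk|h j].
  by have /forallP/(_ k)/implyP/(_ jk)/eqP := h j.
by apply/forallP => k; apply/implyP => /h ->.
Qed.

Lemma homog_p n (pi : {set {set 'I_n}}) : homog n (nc_p pi).
Proof. by apply: homog_ncsum => f; rewrite size_word. Qed.

Lemma nc_p_word n (pi : {set {set 'I_n}}) i :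
  nc_p pi (word i) = (constb pi i)%:R.
Proof.
rewrite /nc_p ncsum_inj; last exact: can_inj (@wordK n).
by case: asboolP => /= [/constbP->|] //; case: constbP.
Qed.

Lemma qsym_p n (pi : {set {set 'I_n}}) : qsym n (nc_p pi).
Proof.
split=> [|i i' e]; first exact: homog_p.
rewrite !nc_p_word; congr (nat_of_bool _)%:R.
by apply: eq_forallb => j; apply: eq_forallb => k; rewrite (ordeq_eq e).
Qed.

(** A function constant on blocks is a function on the set of blocks, and expanding the product of
    sums yields one term for each of these. *)
Lemma sum_constb (T : finType) (x0 : T) (W : T -> rat) n
    (pi : {set {set 'I_n}}) : set_partition pi ->
  \sum_(t : {ffun 'I_n -> T} | constb pi t) \prod_j W (t j) =
  \prod_(B in pi) \sum_x W x ^+ #|B|.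
Proof.
move=> pp; rewrite (big_distr_big x0).
pose h (g : {ffun {set 'I_n} -> T}) := [ffun j => g (finset.pblock pi j)].
(* The value at a block is read off any of its elements; outside [pi] it is [x0], as the support
   condition of the expanded product demands. *)
pose h' (t : {ffun 'I_n -> T}) : {ffun {set 'I_n} -> T} :=
  [ffun B : {set 'I_n} =>
     if B \in pi then if [pick j in B] is Some j then t j else x0 else x0].
rewrite (reindex_onto h h') => [|t /constbP ct]; last first.
  apply/ffunP => j; rewrite !ffunE pblock_in //.
  case: pickP => [k kj|/(_ j)]; last by rewrite pblock_refl.
  by apply: ct; rewrite same_blockE // -(mem_blockE pp _ (pblock_in pp j)).

apply: eq_big => [g|g _].
  apply/andP/pffun_onP => [[_ /eqP <-]|[sg _]].
    split=> [|x _ //]; apply/fintype.subsetP => B.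
    by rewrite inE /= ffunE; case: ifP; rewrite ?eqxx.
  split.
    by apply/constbP => j k; rewrite same_blockE // !ffunE => /eqP ->.
  apply/eqP/ffunP => B; rewrite ffunE; case: ifP => [Bpi|nB].
    case: pickP => [j jB|B0]; first by rewrite ffunE (pblockE pp Bpi jB).
    have /set0Pn[j] := finset.partition_neq0 pp Bpi.
    by rewrite -[_ \in _]/(j \in B) B0.
  apply/esym/eqP; apply: contraFT nB => gB.
  move/fintype.subsetP: sg; apply; rewrite inE; exact: gB.
transitivity (\prod_(j in [set: 'I_n]) W (h g j)).
  by apply: eq_bigl => j; rewrite inE.
rewrite (set_partition_big _ pp); apply: eq_bigr => B Bpi.
rewrite -prodr_const; apply: eq_bigr => j jB.
by rewrite ffunE (pblockE pp Bpi jB).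
Qed.

(** * Theta on power sums *)

Lemma spread_constb n k (pi : {set {set 'I_n}}) (i : {ffun 'I_n -> nat})
    (t : {ffun 'I_n -> 'I_k.+1}) :
  constb pi (spread i t) = constb pi i && constb pi t.
Proof.
apply/constbP/andP => [h|[/constbP hi /constbP ht] x y xy].
  split; apply/constbP => x y /h e.
    by rewrite -(spread_div i t x) e spread_div.
  move: (e); rewrite !ffunE -(spread_div i t x) e spread_div => /addnI.
  have := ltn_ord (t x); have := ltn_ord (t y) => ly lx E.
  by apply: val_inj => /=; lia.
by rewrite !ffunE (hi _ _ xy) (ht _ _ xy).
Qed.

Lemma fdiff_nil_prod (I : Type) (r : seq I) (F : I -> nat -> rat) :
  (forall i, fdiff_nil 2 (F i)) ->
  fdiff_nil (size r).+1 (fun k => \prod_(i <- r) F i k).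
Proof.
move=> nF; elim: r => [|i r IH].
  apply: (eq_fdiff_nil (f := fun=> 1)) => [k|]; first by rewrite big_nil.
  exact: fdiff_nil_cst.
apply: (eq_fdiff_nil (f := fun k => F i k * \prod_(j <- r) F j k)) => [k|].
  by rewrite big_cons.
exact: (@fdiff_nilM 1 (size r)).
Qed.

Lemma Theta0_p n (pi : {set {set 'I_n}}) : set_partition pi ->
  Theta0 (nc_p pi) = (\prod_(B in pi) (1 - (-1) ^+ #|B|) : rat) *: nc_p pi.
Proof.
move=> pp; apply: (homog_ext (n := n)).
- exact/homog_Theta0/homog_p.
- exact/homogZ/homog_p.
move=> i; rewrite Theta0_word /Theta0_at fctE nc_p_word.
(* With one positive and k negative copies, a block B contributes 1 + k (-1)^|B|; this is [c] at k +
   1, as [at_minus1E] requires, whence [j%:R - 1]. *)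
pose c (j : nat) : rat := \prod_(B <- enum pi) (1 + (j%:R - 1) * (-1) ^+ #|B|).
rewrite (eq_at_minus1 _ (g := fun k => (constb pi i)%:R * c k.+1)) => [|k].
  rewrite at_minus1Z at_minus1E.
    rewrite mulrC -[RHS]/(_ * _) /c big_enum; congr (_ * _).
    by apply: eq_bigr => B _; ring.
  (* The degree is at most the number of blocks, which does not exceed the cut-off order [n]. *)
  apply: (@fdiff_nil_leq #|pi|.+1); first exact: card_set_partition.
  rewrite cardE; apply: fdiff_nil_prod => B k.
  by rewrite /= /fdiff -!natr1; ring.
rewrite /c big_enum /= -natr1 addrK.
rewrite (eq_bigr (fun B : {set 'I_n} =>
    \sum_(x < k.+1) level_weight x ^+ #|B|)) => [|B _].
  rewrite -(sum_constb ord0 _ pp) big_distrr [RHS]big_mkcond.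
  apply: eq_bigr => t _ /=; rewrite nc_p_word spread_constb.
  by case: (constb pi i); case: (constb pi t); rewrite /= ?mulr1 ?mul1r ?mulr0 ?mul0r.
rewrite big_ord_recl /= {1}/level_weight eqxx expr1n; congr (_ + _).
rewrite (eq_bigr (fun=> (-1) ^+ #|B|)) => [|x _].
  by rewrite sumr_const card_ord mulr_natl.
by rewrite /level_weight.
Qed.

Lemma prod_one_sub_sign n (pi : {set {set 'I_n}}) :
  (\prod_(B in pi) (1 - (-1) ^+ #|B|) : rat) =
  if [forall B in pi, odd #|B|] then 2%:R ^+ #|pi| else 0.
Proof.
case: ifP => [/forall_inP od|/negbT].
  rewrite -prodr_const; apply: eq_bigr => B /od oB.
  by rewrite -signr_odd oB opprK.
rewrite negb_forall_in => /exists_inP[B Bpi /negbTE eB].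
by rewrite (bigD1 B) //= -signr_odd eB subrr mul0r.
Qed.

Lemma Theta_p n (pi : {set {set 'I_n}}) : set_partition pi ->
  Theta_NCQSym (nc_p pi) =
    (if [forall B in pi, odd #|B|] then 2%:R ^+ #|pi| else 0 : rat) *: nc_p pi.
Proof.
move=> pp; have [_ ->] := qsym_agrees (qsym_p pi).
by rewrite Theta0_p // prod_one_sub_sign.
Qed.

(** * Power sums span NCSym *)

Definition ker_partition n (i : {ffun 'I_n -> nat}) : {set {set 'I_n}} :=
  preim_partition i [set: 'I_n].

Lemma ker_partitionP n (i : {ffun 'I_n -> nat}) :
  set_partition (ker_partition i).
Proof. exact: preim_partitionP. Qed.

Lemma same_block_ker n (i : {ffun 'I_n -> nat}) j k :
  same_block (ker_partition i) j k = (i j == i k).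
Proof.
have kp := ker_partitionP i.
rewrite same_blockE // eq_sym -(mem_blockE kp _ (pblock_in kp j)).
by rewrite pblock_equivalence_partition ?inE // => x y z _ _ _; split=> // /eqP ->.
Qed.

Lemma homog_m n (pi : {set {set 'I_n}}) : homog n (nc_m pi).
Proof. by apply: homog_ncsum => f; rewrite size_word. Qed.

Lemma nc_m_word n (pi : {set {set 'I_n}}) i : set_partition pi ->
  nc_m pi (word i) = (pi == ker_partition i)%:R.
Proof.
move=> pp; rewrite /nc_m ncsum_inj; last exact: can_inj (@wordK n).
case: asboolP => [h|h]; case: eqP => // e.
  case: e; apply: same_block_inj => //; first exact: ker_partitionP.
  by move=> j k; rewrite same_block_ker; apply/idP/eqP => /h.
by case: h => j k; rewrite e same_block_ker; split => /eqP.
Qed.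

Definition refines n (pi sg : {set {set 'I_n}}) : bool :=
  [forall j, forall k, same_block pi j k ==> same_block sg j k].

Lemma refinesP n (pi sg : {set {set 'I_n}}) :
  reflect (forall j k, same_block pi j k -> same_block sg j k) (refines pi sg).
Proof.
apply: (iffP forallP) => [h j k|h j].
  by have /forallP/(_ k)/implyP := h j.
by apply/forallP => k; apply/implyP; apply: h.
Qed.

(** Its size serves as a rank: it grows strictly when a partition is properly coarsened. *)
Definition block_pairs n (pi : {set {set 'I_n}}) : {set 'I_n * 'I_n} :=
  [set p | same_block pi p.1 p.2].

Lemma refines_card n (pi sg : {set {set 'I_n}}) :
  set_partition pi -> set_partition sg -> refines pi sg -> pi != sg ->
  (#|block_pairs pi| < #|block_pairs sg|)%N.
Proof.
move=> pp ps /refinesP r ne; apply: proper_card; rewrite finset.properEneq.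
apply/andP; split; last by apply/fintype.subsetP => -[j k]; rewrite !inE; apply: r.
apply: contra ne => /eqP/setP e; apply/eqP; apply: same_block_inj => // j k.
by have := e (j, k); rewrite !inE.
Qed.

(** Group the words by their kernel: a word is constant on the blocks of [pi] exactly when [pi]
    refines its kernel. *)
Lemma nc_p_sum n (pi : {set {set 'I_n}}) :
  nc_p pi = \sum_(sg | set_partition sg) (refines pi sg)%:R *: nc_m sg.
Proof.
apply: homog_ext => [||i]; first exact: homog_p.
  by apply: homog_sum => sg _; apply/homogZ/homog_m.
rewrite nc_p_word sum_apply (bigD1 (ker_partition i)) ?ker_partitionP //=.
rewrite big1 => [|sg /andP[psg ne]]; rewrite fctE nc_m_word ?ker_partitionP //.
  rewrite eqxx addr0 [_ *: _]mulr1; congr (nat_of_bool _)%:R.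
  by apply: eq_forallb => j; apply: eq_forallb => k; rewrite same_block_ker.
by rewrite (negbTE ne) scaler0.
Qed.

Lemma NCSym_closed : lin_closed NCSym.
Proof. exact: span_lin_closed. Qed.

Lemma NCSym_p n (pi : {set {set 'I_n}}) : NCSym (nc_p pi).
Proof.
rewrite nc_p_sum; apply: (lin_closed_sum NCSym_closed) => sg psg.
by apply: (lin_closedZ NCSym_closed); apply: span_gen; exists n, sg.
Qed.

(** By triangularity for refinement each m is a combination of power sums, so a linear property of
    [NCSym] may be checked on power sums. *)
Lemma NCSym_p_ind (P : ncseries -> Prop) f : lin_closed P ->
  (forall n (pi : {set {set 'I_n}}), set_partition pi -> P (nc_p pi)) ->
  NCSym f -> P f.
Proof.
move=> cP Pp; apply: span_closed => // _ [n [pi [pp ->]]].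
move: pi pp; apply: (triangular_closed cP (G := @set_partition n)
  (rank := fun sg : {set {set 'I_n}} => (n * n - #|block_pairs sg|)%N)
  (a := fun pi sg : {set {set 'I_n}} => (refines pi sg)%:R)
  (F := fun pi => nc_p pi)).
- exact: Pp.
- by move=> pi _; apply: nc_p_sum.
- move=> pi _; have -> : refines pi pi by apply/refinesP.
  by rewrite oner_eq0.
- move=> pi sg pp ps; case: (boolP (refines pi sg)) => // r _; rewrite eq_sym.
  move=> /(refines_card pp ps r).
  have : (#|block_pairs sg| <= n * n)%N.
    by rewrite -[X in (_ <= X * X)%N]card_ord -card_prod max_card.
  by lia.
Qed.

Lemma NCSym_NCQSym f : NCSym f -> NCQSym f.
Proof.
apply: NCSym_p_ind => [|n pi _]; first exact: span_lin_closed.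
by have [] := qsym_agrees (qsym_p pi).
Qed.

(** * Complete and elementary functions *)

Lemma porbits_partition n (s : 'S_n) : set_partition (porbits s).
Proof.
suff -> : porbits s = preim_partition (porbit s) [set: 'I_n].
  exact: preim_partitionP.
have orb j : [set k in [set: 'I_n] | porbit s j == porbit s k] = porbit s j.
  by apply/setP => k; rewrite !inE eq_sym eq_porbit_mem.
apply/setP => B; apply/imsetP/imsetP => -[j _ ->]; exists j => //;
  by rewrite ?inE // orb.
Qed.

Lemma same_block_porbits n (s : 'S_n) j k :
  same_block (porbits s) j k = (k \in porbit s j).
Proof.
have pp := porbits_partition s; rewrite same_blockE // eq_sym.
have orb x : finset.pblock (porbits s) x = porbit s x.
  by apply: pblockE => //; [apply: imset_f|apply: porbit_id].
by rewrite !orb eq_porbit_mem.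
Qed.

Definition fixes n (i : {ffun 'I_n -> nat}) (s : 'S_n) : bool :=
  [forall j, i (s j) == i j].

Lemma constb_porbits n (s : 'S_n) (i : {ffun 'I_n -> nat}) :
  constb (porbits s) i = fixes i s.
Proof.
apply/constbP/forallP => [h j|h j k].
  apply/eqP/esym/h; rewrite same_block_porbits.
  by have := mem_porbit s 1 j; rewrite expg1.
rewrite same_block_porbits => /porbitP[m ->].
elim: m => [|m IH]; first by rewrite expg0 perm1.
by rewrite expgSr permM (eqP (h _)).
Qed.

(** * Permutations that preserve a coloring *)

Section ColorCount.
Context (n : nat) (C : eqType) (k : 'I_n -> C).

(** Only points with a color in [l] may move, which permits induction on the list of colors. *)
Let color_perms (l : seq C) : {set 'S_n} :=
  [set s : 'S_n | [forall j, (k (s j) == k j) && ((k j \in l) || (s j == j))]].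

Lemma color_permsP l (s : 'S_n) :
  reflect (forall j, k (s j) = k j /\ (k j \notin l -> s j = j))
    (s \in color_perms l).
Proof.
rewrite inE; apply: (iffP forallP) => h j.
  have /andP[/eqP-> /orP[->|/eqP ->]] := h j; by split.
have [-> e] := h j; rewrite eqxx /=; case: (boolP (k j \in l)) => // /e->.
by rewrite eqxx.
Qed.

(** Such a permutation factors uniquely as a permutation of the class of [c] followed by one that
    moves only points with a color in [l]. *)
Lemma card_color_perms_cons c l : c \notin l ->
  #|color_perms (c :: l)| = (#|[set j | k j == c]| `! * #|color_perms l|)%N.
Proof.
move=> cl; set B := [set j | k j == c].
rewrite -card_perm -(cardsE (perm_on B)) -cardsX.
have inB j : (j \in B) = (k j == c) by rewrite inE.
rewrite -(@card_in_imset _ _ (fun p : 'S_n * 'S_n => (p.1 * p.2)%g)); last first.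
  move=> [a b] [a' b'] /setXP[/= /[1!inE] pa /color_permsP pb].
  move=> /setXP[/= /[1!inE] pa' /color_permsP pb'] e.
  have eaa : a = a'.
    apply/permP => j; case: (boolP (j \in B)) => jB; last first.
      by rewrite (out_perm pa jB) (out_perm pa' jB).
    have fx (x y : 'S_n) z : perm_on B x -> (forall j, k (y j) = k j /\
        (k j \notin l -> y j = j)) -> z \in B -> y (x z) = x z.
      move=> px py zB; apply: (proj2 (py _)).
      by have := perm_closed z px; rewrite zB inB => /eqP->.
    have /permP/(_ j) := e.
    by rewrite !permM (fx a b) // (fx a' b').
  by move: e; rewrite eaa => /mulgI ->.
congr #|pred_of_set _|; apply/setP => s; apply/idP/imsetP; last first.
  move=> [[a b] /setXP[/= /[1!inE] pa /color_permsP pb] ->]; apply/color_permsP => j.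
  have kB x : k (a x) = k x.
    case: (boolP (x \in B)) => xB; last by rewrite (out_perm pa).
    have := perm_closed x pa; rewrite xB inB => /eqP->.
    by move: xB; rewrite inB => /eqP.
  rewrite permM (proj1 (pb _)) kB; split=> // /norP[jc jl].
  by rewrite (proj2 (pb _)) ?kB // (out_perm pa) // inB.
move=> /color_permsP hs.
(* The first factor is [s] on the class of [c] and the identity elsewhere; the second is the
   quotient. *)
pose F j := if k j == c then s j else j.
have Finj : injective F.
  move=> x y; rewrite /F; case: eqP => ex; case: eqP => ey // e.
  - exact: perm_inj e.
  - by case: ey; rewrite -e (proj1 (hs x)).
  - by case: ex; rewrite e (proj1 (hs y)).
pose a := perm Finj; exists (a, (a^-1 * s)%g); last by rewrite /= mulKVg.
have aB j : k (a j) = k j.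
  by rewrite permE /F; case: ifP => // _; rewrite (proj1 (hs j)).
have aVB j : k ((a^-1)%g j) = k j by rewrite -{2}(permKV a j) aB.
apply/setXP; split=> /=.
  rewrite inE; apply/fintype.subsetP => j; rewrite -[j \in _]/(a j != j) inB permE /F.
  by case: (k j == c) => //; rewrite eqxx.
apply/color_permsP => j; rewrite permM (proj1 (hs _)) aVB; split=> // jl.
case: (k j =P c) => [jc|jc].
  by rewrite -{2}(permKV a j) [RHS]permE /F aVB jc eqxx.
have aj : (a^-1)%g j = j.
  by apply: (@perm_inj _ a); rewrite permKV permE /F; case: eqP.
by rewrite aj (proj2 (hs _)) // inE negb_or jl andbT; apply/eqP.
Qed.

Lemma card_color_perms l : uniq l -> (forall j, k j \in l) ->
  #|[set s : 'S_n | [forall j, k (s j) == k j]]| =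
  \prod_(c <- l) #|[set j | k j == c]| `!.
Proof.
move=> ul kl; have -> : [set s : 'S_n | [forall j, k (s j) == k j]] = color_perms l.
  by apply/setP => s; rewrite !inE; apply: eq_forallb => j; rewrite kl andbT.
elim: l ul {kl} => [_|c l IH /= /andP[cl ul]].
  rewrite big_nil; apply/eqP/cards1P; exists 1%g.
  apply/setP => s; rewrite [RHS]inE; apply/color_permsP/eqP => [h|-> j].
    by apply/permP => j; rewrite perm1; apply: (proj2 (h j)).
  by rewrite perm1.
by rewrite big_cons card_color_perms_cons // IH.
Qed.

End ColorCount.

Definition stab n (pi : {set {set 'I_n}}) (s : 'S_n) : bool :=
  [forall j, finset.pblock pi (s j) == finset.pblock pi j].

(** With each position colored by its block and its letter, the product of factorials counts the
    color-preserving permutations. *)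
Lemma h_coefE n (pi : {set {set 'I_n}}) (i : {ffun 'I_n -> nat}) :
  set_partition pi -> h_coef pi i = #|[set s | stab pi s && fixes i s]|.
Proof.
move=> pp; pose k j := (finset.pblock pi j, i j).
have -> : [set s | stab pi s && fixes i s] =
    [set s : 'S_n | [forall j, k (s j) == k j]].
  apply/setP => s; rewrite !inE; apply/andP/forallP => [[/forallP a /forallP b] j|h].
    by rewrite /k (eqP (a j)) (eqP (b j)).
  by split; apply/forallP => j; have := h j; rewrite xpair_eqE => /andP[].
rewrite (@card_color_perms _ _ k
  [seq (B, v) | B <- enum pi, v <- undup (word i)]).
- rewrite big_allpairs big_enum; apply: eq_bigr => B Bpi; apply: eq_bigr => v _.
  congr (_`!); apply: eq_card => j; rewrite !inE /k xpair_eqE.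
  by rewrite (mem_blockE pp _ Bpi).
- apply: allpairs_uniq; [exact: enum_uniq|exact: undup_uniq|].
  by move=> [a b] [c d].
- move=> j; apply/allpairsP; exists (k j).
  by rewrite mem_enum pblock_in // mem_undup mem_word.
Qed.

Lemma homog_h n (pi : {set {set 'I_n}}) : homog n (nc_h pi).
Proof. by apply: homog_ncsum => f; rewrite size_word. Qed.

Lemma homog_e n (pi : {set {set 'I_n}}) : homog n (nc_e pi).
Proof. by apply: homog_ncsum => f; rewrite size_word. Qed.

Lemma nc_h_perm_sum n (pi : {set {set 'I_n}}) : set_partition pi ->
  nc_h pi = \sum_(s | stab pi s) nc_p (porbits s).
Proof.
move=> pp; apply: homog_ext => [||i]; first exact: homog_h.
  by apply: homog_sum => s _; apply: homog_p.
rewrite sum_apply /nc_h ncsum_inj; last exact: can_inj (@wordK n).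
rewrite asboolT // h_coefE // -sum1_card natr_sum.
rewrite (eq_bigl (fun s => stab pi s && fixes i s)) => [|s]; last by rewrite inE.
rewrite big_mkcondr; apply: eq_bigr => s _.
by rewrite nc_p_word constb_porbits; case: fixes.
Qed.

(* If two letters of a block agree, composing with their transposition is a
   sign-reversing involution of the stabilizer. *)
Lemma nc_e_perm_sum n (pi : {set {set 'I_n}}) : set_partition pi ->
  nc_e pi = \sum_(s | stab pi s) ((-1) ^+ odd_perm s : rat) *: nc_p (porbits s).
Proof.
move=> pp; apply: homog_ext => [||i]; first exact: homog_e.
  by apply: homog_sum => s _; apply/homogZ/homog_p.
rewrite sum_apply /nc_e ncsum_inj; last exact: can_inj (@wordK n).
rewrite (eq_bigr (fun s : 'S_n => if fixes i s then (-1) ^+ odd_perm s else 0 : rat));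
  last first.
  move=> s _; rewrite fctE nc_p_word constb_porbits.
  by case: fixes; [rewrite [_ *: _]mulr1|rewrite [_ *: _]mulr0].
rewrite -big_mkcondr; case: asboolP => [h|h].
  (* With distinct letters in each block, only the identity preserves both blocks and letters. *)
  rewrite (big_pred1 1%g) ?odd_perm1 // => s /=.
  apply/andP/eqP => [[/forallP st /forallP fx]|->]; last first.
    by split; apply/forallP => j; rewrite perm1.
  apply/permP => j; rewrite perm1; have [//|ne] := eqVneq (s j) j.
  by case: (h _ _ (elimN eqP ne)); [rewrite same_blockE|apply/eqP].
have [j [k [jk b e]]] : exists j k, [/\ j != k, same_block pi j k & i j = i k].
  apply: contra_notP h => no j k /eqP jk b e; case: no.
  by exists j, k.
pose t := tperm j k.
have fix_t x : i (t x) = i x by rewrite /t; case: tpermP => [->|->|].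
have stab_t x : finset.pblock pi (t x) = finset.pblock pi x.
  by rewrite /t; case: tpermP => [->|->|] //; apply/eqP;
    rewrite -same_blockE // same_blockE // eq_sym -same_blockE.
set S := \sum_(_ | _) _; suff : S = - S by move=> E; lra.
rewrite {1}/S (reindex_inj (mulgI t)) /= -sumrN; apply: eq_big => s.
  congr andb; apply/forallP/forallP => h' x; have := h' (t x);
    by rewrite permM ?tpermK ?stab_t ?fix_t.
by move=> _; rewrite odd_permM odd_tperm jk signr_addb mulN1r.
Qed.

Lemma stab_refines n (pi : {set {set 'I_n}}) s : set_partition pi ->
  stab pi s -> refines (porbits s) pi.
Proof.
move=> pp /forallP st; apply/refinesP => j k.
rewrite same_block_porbits same_blockE // => /porbitP[m ->].
elim: m => [|m IH]; first by rewrite expg0 perm1.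
by rewrite expgSr permM (eqP (st _)).
Qed.

(** Let [s] run cyclically through each block. This makes the diagonal coefficients in the expansion
    of h over power sums nonzero. *)
Lemma partition_porbits n (pi : {set {set 'I_n}}) : set_partition pi ->
  exists s, stab pi s /\ porbits s = pi.
Proof.
move=> pp; pose b j := enum (finset.pblock pi j).
have ub j : uniq (b j) by apply: enum_uniq.
have memb j k : (k \in b j) = (finset.pblock pi k == finset.pblock pi j).
  by rewrite mem_enum (mem_blockE pp _ (pblock_in pp j)).
pose F j := next (b j) j.
have bF j : b (F j) = b j.
  have /eqP e : finset.pblock pi (F j) == finset.pblock pi j.
    by rewrite -memb mem_next memb.
  by rewrite /b e.
have Finj : injective F.
  move=> x y e; have eb : b x = b y by rewrite -bF e bF.
  by rewrite -(prev_next (ub x) x) -/(F x) e /F eb prev_next.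
pose s := perm Finj.
have sb j : b (s j) = b j by rewrite permE bF.
have st : stab pi s.
  by apply/forallP => j; rewrite -memb permE mem_next memb.
exists s; split=> //; apply: same_block_inj => //; first exact: porbits_partition.
move=> j k; apply/idP/idP; first by have /refinesP := stab_refines pp st; apply.
rewrite same_block_porbits same_blockE // eq_sym -memb => kj.
have jj : j \in b j by rewrite memb.
have con : fconnect (next (b j)) j k.
  by rewrite (fconnect_cycle (cycle_next (ub j)) jj).
rewrite -(iter_findex con); move: (findex _ _ _) => m.
suff -> : iter m (next (b j)) j = (s ^+ m)%g j by apply: mem_porbit.
have bm l : b ((s ^+ l)%g j) = b j.
  by elim: l => [|l IH]; [rewrite expg0 perm1|rewrite expgSr permM sb].
elim: m => [|m IH] /=; first by rewrite expg0 perm1.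
by rewrite IH expgSr permM permE /F bm.
Qed.

(** * The action of omega on power sums *)

Lemma NCSym_h n (pi : {set {set 'I_n}}) : set_partition pi -> NCSym (nc_h pi).
Proof.
move=> pp; rewrite nc_h_perm_sum //; apply: (lin_closed_sum NCSym_closed) => s _.
exact: NCSym_p.
Qed.

(** The sign of any permutation whose cycles are the blocks of [pi]. *)
Definition omega_sign n (pi : {set {set 'I_n}}) : rat := (-1) ^+ (n + #|pi|).

Lemma odd_perm_porbits n (s : 'S_n) :
  (-1) ^+ odd_perm s = omega_sign (porbits s).
Proof. by rewrite /omega_sign /odd_perm card_ord -oddD signr_odd. Qed.

(** The pairs (h, e) expand over the pairs (p, sign times p) with common triangular coefficients.
    Inverting this one system in the product space puts the latter pairs on the graph of [w], which
    is closed under linear combinations. *)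
Lemma omega_p w n (pi : {set {set 'I_n}}) : is_omega w -> set_partition pi ->
  w (nc_p pi) = omega_sign pi *: nc_p pi.
Proof.
move=> [lw _ wh] pp.
pose P (p : ncseries * ncseries) := NCSym p.1 /\ w p.1 = p.2.
have cP : lin_closed P.
  have [S0 SD] := NCSym_closed.
  split=> [|a u v [Su eu] [Sv ev]]; first by split=> //; apply: linear_on0 lw S0.
  by split; [apply: SD|rewrite lw // eu ev].
pose a (pi sg : {set {set 'I_n}}) : rat :=
  #|[set s | stab pi s && (porbits s == sg)]|%:R.
suff [_ ->] : P (nc_p pi, omega_sign pi *: nc_p pi) by [].
move: pi pp; apply: (triangular_closed cP (G := @set_partition n)
  (rank := fun sg : {set {set 'I_n}} => #|block_pairs sg|) (a := a)
  (M := fun pi => (nc_p pi, omega_sign pi *: nc_p pi))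
  (F := fun pi => (nc_h pi, nc_e pi))).
- by move=> pi pp; split; [apply: NCSym_h|apply: wh].
- move=> pi pp; rewrite nc_h_perm_sum // nc_e_perm_sum //.
  transitivity (\sum_(s | stab pi s)
     (nc_p (porbits s), omega_sign (porbits s) *: nc_p (porbits s))).
    by elim/big_rec3: _ => [//|s x y z _ <-]; rewrite odd_perm_porbits.
  rewrite (partition_big (@porbits _) (@set_partition n)) => [|s _]; last first.
    exact: porbits_partition.
  apply: eq_bigr => sg _.
  rewrite (eq_bigr (fun=> (nc_p sg, omega_sign sg *: nc_p sg))); last first.
    by move=> s /andP[_ /eqP ->].
  rewrite sumr_const scaler_nat; congr (_ *+ _).
  by apply: eq_card => s; rewrite inE.
- move=> pi pp; rewrite pnatr_eq0 -lt0n card_gt0; apply/set0Pn.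
  by have [s [ss es]] := partition_porbits pp; exists s; rewrite inE ss es eqxx.
- move=> pi sg pp ps; rewrite pnatr_eq0 -lt0n card_gt0 => /set0Pn[s].
  rewrite inE => /andP[ss /eqP <-]; apply: refines_card => //.
    exact: porbits_partition.
  exact: stab_refines.
Qed.

Theorem theorem10p2 :
  (forall (n : nat) (pi : {set {set 'I_n}}),
     (1 <= n)%N -> set_partition pi ->
     Theta_NCSym (nc_p pi) =
       if [forall B in pi, odd #|B|] then (2%:R ^+ #|pi| : rat) *: nc_p pi
       else 0) /\
  (forall f : ncseries, NCSym f ->
     NCSym (Theta_NCSym f) /\
     Theta_NCSym (omega f) = omega (Theta_NCSym f)).
Proof.
have ThetaE f : NCSym f -> Theta_NCSym f = Theta_NCQSym f.
  by move=> Sf; rewrite /Theta_NCSym /patch mem_set.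
have [lT _] := Theta_NCQSymP.
have [S0 SD] := NCSym_closed; have Z := lin_closedZ NCSym_closed.
have lTS : linear_on NCSym Theta_NCSym.
  move=> a u v Su Sv; rewrite !ThetaE //; last exact: SD.
  by apply: lT; apply: NCSym_NCQSym.
have TZ a u : NCSym u -> Theta_NCSym (a *: u) = a *: Theta_NCSym u.
  by move=> Su; have := lTS a u 0 Su S0; rewrite (linear_on0 lTS) // !addr0.
have Tp n (pi : {set {set 'I_n}}) : set_partition pi ->
    exists c : rat, Theta_NCSym (nc_p pi) = c *: nc_p pi.
  by move=> pp; rewrite ThetaE ?Theta_p //; [eexists|exact: NCSym_p].
split=> [n pi _ pp|].
  rewrite ThetaE ?Theta_p //; last exact: NCSym_p.
  by case: ifP => // _; rewrite scale0r.
(* The power sums span and each is an eigenvector, so [NCSym] is stable. *)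
have TS f : NCSym f -> NCSym (Theta_NCSym f).
  move=> Sf; pose P f := NCSym f /\ NCSym (Theta_NCSym f).
  suff [] : P f by []; apply: (NCSym_p_ind _ _ Sf) => [|n pi pp].
    split=> [|a u v [Su STu] [Sv STv]]; first by rewrite /P (linear_on0 lTS).
    by rewrite /P lTS //; split; apply: SD.
  have [c Tc] := Tp n pi pp; rewrite /P Tc.
  by split; [exact: NCSym_p|apply/Z/NCSym_p].
move=> f Sf; split; first exact: TS.
(* Either the chosen map satisfies [is_omega], or it is the default zero map and both sides are
   0. *)
rewrite /omega; case: xgetP => [w _ ww|_]; last exact: linear_on0 lTS S0.
have [lw wS _] := ww.
have wZ a u : NCSym u -> w (a *: u) = a *: w u.
  by move=> Su; have := lw a u 0 Su S0; rewrite (linear_on0 lw) // !addr0.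
pose P f := NCSym f /\ Theta_NCSym (w f) = w (Theta_NCSym f).
suff [] : P f by [].
apply: (NCSym_p_ind _ _ Sf) => [|n pi pp].
  split=> [|a u v [Su eu] [Sv ev]].
    by rewrite /P (linear_on0 lw) // (linear_on0 lTS) // (linear_on0 lw).
  split; first exact: SD.
  have [Swu _] := wS u Su; have [Swv _] := wS v Sv.
  by rewrite lw // !lTS // lw ?eu ?ev //; apply: TS.
have Sp := NCSym_p pi; split=> //; have [c Tc] := Tp n pi pp.
(* On a power sum both operators act by rational scalars, which commute. *)
rewrite (omega_p ww pp) TZ // Tc wZ // (omega_p ww pp).
by rewrite !scalerA mulrC.
Qed.
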